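(* Let $E$ be a Polish space, let $c:E\times E\to[0,\infty)$ be a lower semicontinuous quasi-pseudo-metric, and let $g:E\to\mathbb{R}$ be Borel measurable. For all $\gamma\in[0,1]$ and all $X,Y\in\mathcal{L}_{c,g}(E)$ we have $$X\le_{\gamma,g}Y\quad\Longleftrightarrow\quad \mathbb{E}[f(X)]\le\mathbb{E}[f(Y)]\ \text{ for all } f\in\mathcal{F}_{\gamma,g}\cup\{g\},$$ where $$\mathcal{F}_{\gamma,g}:=\{(1-\gamma)f+\gamma g:\ f(x)-f(y)\le c(x,y)\ \text{ for all } x,y\in E\}.$$
   Context: A quasi-pseudo-metric on $E$ is a map $c:E\times E\to[0,\infty)$ with $c(x,x)=0$ for all $x\in E$ and $c(x,z)\le c(x,y)+c(y,z)$ for all $x,y,z\in E$. In the definition of $\mathcal{F}_{\gamma,g}$, $f$ denotes a function $f:E\to\mathbb{R}$. All random variables are defined on a joint probability space. For a Borel measurable $c:E\times E\to[0,\infty)$ and $E$-valued random variables $X,Y$, $\mathrm{OT}_c(X,Y):=\inf \mathbb{E}[c(\tilde X,\tilde Y)]$, where the infimum is over all couplings, i.e. all pairs $(\tilde X,\tilde Y)$ of $E$-valued random variables with $\tilde X\overset{d}{=}X$ and $\tilde Y\overset{d}{=}Y$ (equality in law). $\mathcal{L}_{c,g}(E)$ is the set of $E$-valued random variables $X$ for which there exists $x_0\in E$ with $\mathbb{E}[c(X,x_0)+c(x_0,X)+|g(X)|]<\infty$. For $X,Y\in\mathcal{L}_{c,g}(E)$ with $\mathbb{E}[g(X)]\le\mathbb{E}[g(Y)]$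 define $$\gamma^\ast(X,Y;g):=\frac{\mathrm{OT}_c(X,Y)}{\mathbb{E}[g(Y)]-\mathbb{E}[g(X)]+\mathrm{OT}_c(X,Y)},\qquad 0/0:=0.$$ For $\gamma\in[0,1]$ and $X,Y\in\mathcal{L}_{c,g}(E)$, write $X\le_{\gamma,g}Y$ if $\mathbb{E}[g(X)]\le\mathbb{E}[g(Y)]$ and $\gamma^\ast(X,Y;g)\le\gamma$.
   Formalization: The test functions in F_{γ,g} ∪ {g} are restricted to the Borel measurable ones, because for arbitrary f: E→ℝ (for example the indicator of a non-measurable set with c the discrete metric) the expectation E[f(X)] is undefined. *)

(* Defs.v *)
From HB Require Import structures.
From mathcomp Require Import all_boot all_order all_algebra.
From mathcomp Require Import all_classical all_reals all_analysis.

Set Implicit Arguments.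
Unset Strict Implicit.
Unset Printing Implicit Defensive.

Import Order.TTheory GRing.Theory Num.Theory.
Import numFieldNormedType.Exports.

Local Open Scope classical_set_scope.
Local Open Scope ring_scope.

(* [borel E] is convertible to [E], so a function on [E] is also a function on
   [borel E].  The library attaches generated sigma-algebras to pointed types,
   hence [ptopologicalType] below; an empty space carries no random variable. *)
Notation borel E := (g_sigma_algebraType (@open E)).

Definition polish_space (R : realType) (E : topologicalType) : Prop :=
  (exists D : set E, countable D /\ dense D) /\
  exists dist : E -> E -> R,
    [/\ (forall x y, dist x y = 0 <-> x = y),
        (forall x y, dist x y = dist y x),
        (forall x y z, dist x z <= dist x y + dist y z),
        (forall x (A : set E),
           nbhs x A <-> exists2 e : R, 0 < e & [set y | dist x y < e] `<=` A) &
        (forall u : nat -> E,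
           (forall e : R, 0 < e -> exists N : nat, forall m n : nat,
              (N <= m)%N -> (N <= n)%N -> dist (u m) (u n) < e) ->
           exists l : E, u @ \oo --> l)].

Definition quasi_pseudo_metric (R : realType) (E : Type) (c : E -> E -> R) :
    Prop :=
  [/\ (forall x y, 0 <= c x y),
      (forall x, c x x = 0) &
      (forall x y z, c x z <= c x y + c y z)].

Definition lsc_cost (R : realType) (E : topologicalType) (c : E -> E -> R) :
    Prop :=
  lower_semicontinuous (fun xy : E * E => (c xy.1 xy.2)%:E).

Definition eq_law (R : realType) (d d' d'' : measure_display)
    (T : measurableType d) (T' : measurableType d') (S : measurableType d'')
    (P : probability T R) (P' : probability T' R)
    (X : {RV P >-> S}) (X' : {RV P' >-> S}) : Prop :=
  forall A : set S, measurable A -> distribution P X A = distribution P' X' A.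

Section fractional_order.
Local Open Scope ereal_scope.
Context (R : realType) (E : ptopologicalType) (c : E -> E -> R) (g : E -> R).
Context (d : measure_display) (Omega : measurableType d)
  (P : probability Omega R).
Implicit Types X Y : {RV P >-> borel E}.

(* A coupling may live on any probability space: the one carrying X and Y
   need not be rich enough to realise every joint law. *)
Definition coupling_costs X Y : set (\bar R) :=
  [set v | exists (d' : measure_display) (Omega' : measurableType d')
      (Q : probability Omega' R) (X' Y' : {RV Q >-> borel E}),
      [/\ eq_law X' X, eq_law Y' Y & v = 'E_Q[fun w => c (X' w) (Y' w)]]].

Definition OT X Y : \bar R := ereal_inf (coupling_costs X Y).

Definition in_L X : Prop :=
  exists x0 : E,
    'E_P[fun w => (c (X w) x0 + c x0 (X w) + `|g (X w)|)%R] < +oo.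

(* Only meaningful for X and Y satisfying [in_L], where OT and both
   expectations are finite.  In a field x / 0 = 0, and here a zero denominator
   forces a zero numerator, so the convention 0/0 := 0 is built in. *)
Definition gamma_star X Y : R :=
  (fine (OT X Y) /
   (fine 'E_P[fun w => g (Y w)] - fine 'E_P[fun w => g (X w)]
    + fine (OT X Y)))%R.

Definition gamma_le (gamma : R) X Y : Prop :=
  'E_P[fun w => g (X w)] <= 'E_P[fun w => g (Y w)] /\
  (gamma_star X Y <= gamma)%R.

Definition gamma_class (gamma : R) : set (E -> R) :=
  [set h | exists2 f : E -> R,
      (forall x y, f x - f y <= c x y)%R &
      h = (fun x => (1 - gamma) * f x + gamma * g x)%R].

End fractional_order.

(* Main.v *)
Require Import Defs.
From HB Require Import structures.
From mathcomp Require Import all_boot all_order all_algebra.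
From mathcomp Require Import all_classical all_reals all_analysis.
From mathcomp Require Import measurable_realfun ring lra.

Import Order.TTheory GRing.Theory Num.Theory.
Import numFieldNormedType.Exports.

Local Open Scope classical_set_scope.
Local Open Scope ring_scope.

Set Implicit Arguments.
Unset Strict Implicit.

(* Put mu and nu for the laws of X and Y.  If E[g(X)] <= E[g(Y)], the order
   relation says (1 - gamma) OT <= gamma (E[g(Y)] - E[g(X)]), so the theorem
   reduces to the duality between OT and sup_f (E[f(X)] - E[f(Y)]), f ranging
   over the Borel functions with f x - f y <= c x y.  Only OT <= sup is hard.

   Let S bound the supremum over bounded f.  If phi x + psi y <= c x y, then the
   c-transform inf_y (c x y - psi y), taken over compact pieces on which psi is
   almost constant, is Borel (the infimum of a lower semicontinuous function
   over a compact set is lower semicontinuous), and it shows that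
   int phi dmu + int psi dnu <= S.  Hence
     p u = inf {int phi dmu + int psi dnu + r S | u <= phi (+) psi + r c, r > 0}
   is finite and sublinear on the bounded functions on E * E, and it dominates
   an additive functional L (a minimal sublinear functional is additive).  The
   set function A * B |-> L (1_(A * B)) has marginals mu and nu, is countably
   additive on rectangles because mu and nu are tight, and therefore extends to
   a coupling Q.  The superlevel sets of c are countable unions of open
   rectangles, so int c dQ <= S follows from the layer-cake formula. *)

(** * Additive minorants of sublinear functionals *)

Section additive_minorant.
Variables (R : realType) (V : zmodType) (B : set V).
Hypothesis BB : forall u v, B u -> B v -> B (u - v).

(** Homogeneity concerns natural multiples only, since [V] is a mere abelian group. [B] will be the
    subgroup of bounded functions, on which the infima involved are finite. *)
Definition nat_sublinear (q : V -> R) : Prop :=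
  (forall u v, B u -> B v -> q (u + v) <= q u + q v) /\
  (forall n u, B u -> q (u *+ n) = q u *+ n).

Hypothesis B0 : B 0.

Let BN u : B u -> B (- u).
Proof. by move=> Bu; rewrite -sub0r; exact: BB. Qed.

Let BD u v : B u -> B v -> B (u + v).
Proof. by move=> Bu Bv; rewrite -[v]opprK; apply: BB => //; exact: BN. Qed.

Let BMn u n : B u -> B (u *+ n).
Proof. by move=> Bu; elim: n => [|n IH]; rewrite ?mulrS//; exact: BD. Qed.

Let sub0 q : nat_sublinear q -> q 0 = 0.
Proof. by move=> [_ /(_ 0%N 0 B0)]; rewrite !mulr0n. Qed.

Let subN q u : nat_sublinear q -> B u -> - q (- u) <= q u.
Proof.
move=> sq Bu; have := sq.1 _ _ Bu (BN Bu).
by rewrite subrr (sub0 sq) -lerBlDr sub0r.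
Qed.

(** The functional [q' w = inf_n (q (w + n v) - n q v)] is sublinear and lies below [q]. Minimality
    gives [q u <= q' u], and the term [n = 1] bounds [q' u] by [q (u + v) - q v]. *)
Let minimal_additive q : nat_sublinear q ->
  (forall q', nat_sublinear q' -> (forall u, B u -> q' u <= q u) ->
    forall u, B u -> q u <= q' u) ->
  forall u v, B u -> B v -> q (u + v) = q u + q v.
Proof.
move=> sq qmin u v Bu Bv; apply/eqP; rewrite eq_le sq.1//=.
pose A w := [set q (w + v *+ n) - q v *+ n | n in [set: nat]].
pose q' w := inf (A w).
have A0 w : A w !=set0 by exists (q (w + v *+ 0) - q v *+ 0), 0%N.
have lbA w n : B w -> - q (- w) <= q (w + v *+ n) - q v *+ n.
  move=> Bw; rewrite lerBrDr addrC lerBlDr -(sq.2 n v Bv).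
  have := sq.1 _ _ (BD Bw (BMn n Bv)) (BN Bw).
  by rewrite [w + _]addrC addrK.
have hA w : B w -> has_inf (A w).
  by move=> Bw; split; [exact: A0|exists (- q (- w)) => _ [n _ <-]; exact: lbA].
have q'le w n : B w -> q' w <= q (w + v *+ n) - q v *+ n.
  by move=> Bw; apply: ge_inf; [exact: (hA w Bw).2|exists n].
have sq' : nat_sublinear q'.
  have q'D a b : B a -> B b -> q' (a + b) <= q' a + q' b.
    move=> Ba Bb; rewrite -lerBlDr; apply: lb_le_inf; first exact: A0.
    move=> _ [n _ <-]; rewrite lerBlDr -lerBlDl.
    apply: lb_le_inf; first exact: A0.
    move=> _ [m _ <-]; rewrite lerBlDr.
    apply: le_trans (q'le _ (n + m)%N (BD Ba Bb)) _.
    have -> : a + b + v *+ (n + m) = (b + v *+ m) + (a + v *+ n).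
      by rewrite mulrnDr addrACA [RHS]addrC.
    rewrite mulrnDr; have := sq.1 _ _ (BD Bb (BMn m Bv)) (BD Ba (BMn n Bv)).
    lra.
  have q'0 : q' 0 = 0.
    apply/eqP; rewrite eq_le; apply/andP; split.
      by have := q'le 0 0%N B0; rewrite !mulr0n addr0 subr0 (sub0 sq).
    apply: lb_le_inf; first exact: A0.
    by move=> _ [n _ <-]; rewrite add0r sq.2// subrr.
  split=> // n w Bw; apply/eqP; rewrite eq_le; apply/andP; split.
    elim: n => [|n IH]; first by rewrite !mulr0n q'0.
    rewrite !mulrS; apply: le_trans (q'D _ _ Bw (BMn n Bw)) _.
    by rewrite lerD2l.
  case: n => [|n]; first by rewrite !mulr0n q'0.
  apply: lb_le_inf; first exact: A0.
  move=> _ [m _ <-].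
  have /le_trans := ler_wMn2r n.+1 (q'le w m Bw); apply.
  rewrite mulrnBl -(sq.2 _ _ (BD Bw (BMn m Bv))) mulrnDl -!mulrnA.
  (* The terms of the infimum decrease with the index, so the term of index [m * n.+1] is at most
     that of index [m]. *)
  have [k ->] : exists k, (m * n.+1 = m + k)%N.
    by exists (m * n)%N; rewrite mulnS.
  rewrite !mulrnDr addrA.
  have := sq.1 _ _ (BD (BMn n.+1 Bw) (BMn m Bv)) (BMn k Bv).
  rewrite (sq.2 k v Bv); lra.
have q'q w : B w -> q' w <= q w.
  by move=> Bw; have := q'le w 0%N Bw; rewrite !mulr0n addr0 subr0.
have := qmin q' sq' q'q u Bu; have := q'le u 1%N Bu; rewrite !mulr1n; lra.
Qed.

(** Zorn's lemma below [p]: a nonempty chain is bounded by its pointwise infimum, which stays finite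
    because a sublinear [t <= p] satisfies [t u >= - p (- u)]. A minimal element is additive. *)
Lemma exists_additive_minorant (p : V -> R) : nat_sublinear p ->
  exists L : V -> R, (forall u, B u -> L u <= p u) /\
    (forall u v, B u -> B v -> L (u + v) = L u + L v).
Proof.
move=> sp.
pose T := {q : V -> R | nat_sublinear q /\ forall u, B u -> q u <= p u}.
have t0 : T by exists p.
(* The order is reversed, so that a maximal element for [Rel] is a minimal functional. *)
pose Rel (q r : T) := `[< forall u, B u -> projT1 r u <= projT1 q u >].
have [||A totA|[q [sq qp]] qmax] := @ZL_preorder T t0 Rel.
- by move=> t; apply/asboolP.
- move=> r s t /asboolP sr /asboolP ts; apply/asboolP => u Bu.
  exact: le_trans (ts u Bu) (sr u Bu).
- have [[a Aa]|A0] := pselect (A !=set0); last first.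
    by exists t0 => s As; exfalso; apply: A0; exists s.
  pose I u := [set projT1 t u | t in A].
  have I0 u : I u !=set0 by exists (projT1 a u), a.
  have hI u : B u -> has_inf (I u).
    move=> Bu; split=> //; exists (- p (- u)) => _ [t At <-].
    apply: le_trans (subN (projT2 t).1 Bu); rewrite lerN2.
    by apply: (projT2 t).2; exact: BN.
  pose m u := inf (I u).
  have mle u (t : T) : B u -> A t -> m u <= projT1 t u.
    by move=> Bu At; apply: ge_inf; [exact: (hI u Bu).2|exists t].
  have sm : nat_sublinear m.
    split=> [u v Bu Bv|n u Bu].
      rewrite -lerBlDr; apply: lb_le_inf => // _ [s As <-].
      rewrite lerBlDr -lerBlDl; apply: lb_le_inf => // _ [t At <-].
      rewrite lerBlDr.
      (* The lower of the chain members [s] and [t] serves at both points. *)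
      have [/asboolP st|/asboolP ts] := totA _ _ As At.
        apply: le_trans (mle _ _ (BD Bu Bv) At) _.
        apply: le_trans ((projT2 t).1.1 _ _ Bu Bv) _.
        by rewrite addrC lerD2l; exact: st.
      apply: le_trans (mle _ _ (BD Bu Bv) As) _.
      apply: le_trans ((projT2 s).1.1 _ _ Bu Bv) _.
      by rewrite addrC lerD2r; exact: ts.
    case: n => [|n].
      rewrite !mulr0n; apply/eqP; rewrite eq_le; apply/andP; split.
        by have := mle 0 a B0 Aa; rewrite (sub0 (projT2 a).1).
      by apply: lb_le_inf => // _ [t At <-]; rewrite (sub0 (projT2 t).1).
    apply/eqP; rewrite eq_le; apply/andP; split; last first.
      apply: lb_le_inf => // _ [t At <-].
      by rewrite (projT2 t).1.2// lerMn2r/=; exact: mle.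
    rewrite -mulr_natl -ler_pdivrMl//; apply: lb_le_inf => // _ [t At <-].
    rewrite ler_pdivrMl// mulr_natl -(projT2 t).1.2//.
    by apply: mle => //; exact: BMn.
  have mp u : B u -> m u <= p u.
    by move=> Bu; apply: le_trans (mle u a Bu Aa) _; exact: (projT2 a).2.
  exists (exist _ m (conj sm mp)) => s As; apply/asboolP => u Bu /=.
  exact: mle.
- exists q; split=> //; apply: minimal_additive => // q' sq' q'q.
  have q'p u : B u -> q' u <= p u.
    by move=> Bu; apply: le_trans (q'q u Bu) (qp u Bu).
  have := qmax (exist _ q' (conj sq' q'p)).
  have H : Rel (exist _ q (conj sq qp)) (exist _ q' (conj sq' q'p)).
    by apply/asboolP.
  by move=> /(_ H) /asboolP.
Qed.

End additive_minorant.

(** * Borel probability measures on Polish spaces *)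

Lemma open_measurable_borel (E : ptopologicalType) (A : set E) :
  open A -> measurable (A : set (borel E)).
Proof. by move=> oA; exact: sub_gen_smallest. Qed.

Lemma closed_measurable_borel (E : ptopologicalType) (A : set E) :
  closed A -> measurable (A : set (borel E)).
Proof.
move=> cA; rewrite -[A]setCK; apply: measurableC; apply: open_measurable_borel.
exact: closed_openC.
Qed.

Lemma probability_nonincreasing_lt (R : realType) d (T : measurableType d)
    (mu : probability T R) (F : (set T)^nat) (x : \bar R) :
  (forall n, measurable (F n)) -> nonincreasing_seq F ->
  (mu (\bigcap_n F n) < x)%E -> exists n, (mu (F n) < x)%E.
Proof.
move=> mF ndF muF; apply: contrapT => /forallNP H.
have muFcvg : mu \o F @ \oo --> mu (\bigcap_n F n).
  apply: nonincreasing_cvg_mu => //; last exact: bigcapT_measurable.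
  by apply: le_lt_trans (probability_le1 _ _) (ltry _).
suff : (x <= mu (\bigcap_n F n))%E by rewrite leNgt muF.
rewrite -(cvg_lim _ muFcvg)//; apply: lime_ge.
  by apply/cvg_ex; eexists; exact: muFcvg.
by apply: nearW => n; rewrite leNgt; apply/negP/H.
Qed.

Section polish.
Variables (R : realType) (E : ptopologicalType) (dist : E -> E -> R).
Hypothesis dist0 : forall x y, dist x y = 0 <-> x = y.
Hypothesis distC : forall x y, dist x y = dist y x.
Hypothesis dist_tri : forall x y z, dist x z <= dist x y + dist y z.
Hypothesis nbhs_dist : forall x (A : set E),
  nbhs x A <-> exists2 e : R, 0 < e & [set y | dist x y < e] `<=` A.

Local Notation ball_ x e := [set y | dist x y < e].

Let distxx x : dist x x = 0.
Proof. exact/dist0. Qed.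

Lemma open_dist_lt x e : open (ball_ x e).
Proof.
rewrite openE => y /= xy; apply/nbhs_dist; exists (e - dist x y).
  by rewrite subr_gt0.
by move=> z /= yz; have := dist_tri x y z; lra.
Qed.

Lemma closed_dist_le x e : closed [set y | dist x y <= e].
Proof.
rewrite -[X in closed X]setCK; apply: open_closedC; rewrite openE => y /=.
move/negP; rewrite -ltNge => xy; apply/nbhs_dist; exists (dist x y - e).
  by rewrite subr_gt0.
move=> z /= yz; apply/negP; rewrite -ltNge.
by have := dist_tri x z y; rewrite [dist z y]distC; lra.
Qed.

Lemma dense_sequence : (exists D : set E, countable D /\ dense D) ->
  exists s : nat -> E, forall x (e : R), 0 < e -> exists n, dist (s n) x < e.
Proof.
move=> [D [/countable_injP[f finj] dD]].
(* When [n] codes no element of [D], [get] returns a default point; such extra terms do not harm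
   density. *)
exists (fun n => [get x | D x /\ f x = n]) => x e e0.
have [y []] : ball_ x e `&` D !=set0.
  apply: dD; last exact: open_dist_lt.
  by exists x => /=; rewrite distxx.
move=> /= xy Dy; exists (f y).
rewrite (get_unique (x := y)) ?[dist y x]distC//.
by move=> z [Dz fz]; apply: finj; rewrite ?inE.
Qed.

Variable s : nat -> E.
Hypothesis s_dense : forall x (e : R), 0 < e -> exists n, dist (s n) x < e.

Lemma countable_base (x : E) (A : set E) : nbhs x A ->
  exists n k, ball_ (s n) k.+1%:R^-1 x /\ ball_ (s n) k.+1%:R^-1 `<=` A.
Proof.
move=> /nbhs_dist[e e0 xA].
have [|k] := @ltr_add_invr _ 0 (e / 2); first by rewrite divr_gt0.
rewrite add0r => ke.
have [|n nx] := s_dense x (e := k.+1%:R^-1); first by rewrite invr_gt0.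
exists n, k; split=> // y /= ny; apply: xA => /=.
have := dist_tri x (s n) y; rewrite [dist x (s n)]distC.
by move: ke nx ny; move: (k.+1%:R^-1) => r; lra.
Qed.

(** * Approximation of Borel sets by closed and open sets *)

Section regularity.
Variable mu : probability (borel E) R.

Let reg (A : set E) := forall e : R, 0 < e -> exists F G : set E,
  [/\ closed F, open G, F `<=` A, A `<=` G & (mu (G `\` F) < e%:E)%E].

(** An open set is the increasing union of the closed sets [F n] of points at distance at least
    [n.+1%:R^-1] from its complement. *)
Let reg_open A : open A -> reg A.
Proof.
move=> oA e e0.
pose F n := [set x | forall y, ~ A y -> n.+1%:R^-1 <= dist x y].
have cF n : closed (F n).
  rewrite (_ : F n = \bigcap_(y in ~` A) [set x | n.+1%:R^-1 <= dist x y])//.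
  apply: closed_bigI => y _; rewrite -[X in closed X]setCK.
  apply: open_closedC; rewrite (_ : ~` _ = ball_ y n.+1%:R^-1).
    exact: open_dist_lt.
  apply/seteqP; split=> z /=; rewrite distC; first by move/negP; rewrite -ltNge.
  by move=> yz; apply/negP; rewrite -ltNge.
have FA n : F n `<=` A.
  move=> x Fx; apply: contrapT => /Fx; rewrite distxx leNgt invr_gt0 ltr0n.
  by [].
have [n Hn] : exists n, (mu (A `\` F n) < e%:E)%E.
  apply: probability_nonincreasing_lt.
  - move=> n; apply: measurableD; first exact: open_measurable_borel.
    exact: closed_measurable_borel.
  - apply/nonincreasing_seqP => n; apply/subsetPset; apply: setDS => x Fx y Ay.
    by apply: le_trans (Fx y Ay); rewrite lef_pV2 ?posrE// ler_nat.
  - rewrite (_ : \bigcap_n _ = set0) ?measure0 ?lte_fin//.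
    rewrite -subset0 => x AFx; have [Ax _] := AFx 0%N I.
    have /nbhs_dist[r r0 xA] : nbhs x A by exact: open_nbhs_nbhs.
    have [n] := ltr_add_invr r0; rewrite add0r => nr.
    have [_] := AFx n I; apply => y Ay; rewrite leNgt; apply/negP => yn.
    by apply: Ay; apply: xA => /=; exact: lt_trans nr.
by exists (F n), A; split=> //; exact: FA.
Qed.

Let reg_C A : reg A -> reg (~` A).
Proof.
move=> rA e e0; have [F [G [cF oG FA AG muGF]]] := rA e e0.
exists (~` G), (~` F); split; rewrite ?closedC//; first exact: closed_openC.
- exact: subsetC.
- exact: subsetC.
- by rewrite setDE setCK setIC -setDE.
Qed.

Let reg_bigcup (A : (set E)^nat) : (forall n, reg (A n)) ->
  reg (\bigcup_n A n).
Proof.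
move=> rA e e0.
have e2 n : 0 < e / 2 / (2 ^ n.+1)%:R by rewrite !divr_gt0// ltr0n expn_gt0.
have /choice[F /choice[G FG]] n := rA n _ (e2 n).
have mF n : measurable (F n : set (borel E)).
  by apply: closed_measurable_borel; have [] := FG n.
have mG n : measurable (G n : set (borel E)).
  by apply: open_measurable_borel; have [] := FG n.
(* The union of all [F n] need not be closed, so it is cut at a finite stage [N]. The sets [H N]
   decrease to a set covered by the differences of [G n] and [F n], whose masses sum to at most
   [e / 2]. *)
pose H N := \bigcup_n G n `\` \bigcup_(n < N) F n.
have [N HN] : exists N, (mu (H N) < e%:E)%E.
  apply: probability_nonincreasing_lt.
  - move=> N; apply: measurableD; first exact: bigcupT_measurable.
    by apply: bigcup_measurable => n _.
  - apply/nonincreasing_seqP => n; apply/subsetPset; apply: setDS.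
    by apply: bigcup_sub => i /= ni; apply: bigcup_sup => /=; exact: ltnW.
  - apply: (@le_lt_trans _ _ (e / 2)%:E); last first.
      by rewrite lte_fin; lra.
    apply: le_trans (epsilon_trick0 _ (ltW _)); last by rewrite divr_gt0.
    apply: (@le_trans _ _ (\sum_(n <oo) mu (G n `\` F n))%E).
      apply: (measure_sigma_subadditive mu).
      + by move=> n; apply: measurableD.
      + apply: bigcapT_measurable => N; apply: measurableD.
          exact: bigcupT_measurable.
        by apply: bigcup_measurable => n _.
      + move=> x Hx; have [[n _ Gx] _] := Hx 0%N I; exists n => //.
        split=> // Fx; have [_] := Hx n.+1 I; apply.
        by exists n => /=.
    apply: lee_nneseries => // n _; apply: ltW; by have [] := FG n.
exists (\bigcup_(n < N) F n), (\bigcup_n G n); split=> //.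
- by apply: closed_bigcup => [|n _]; [exact: finite_II|have [] := FG n].
- by apply: bigcup_open => n _; have [] := FG n.
- by move=> x [n _ Fx]; exists n => //; have [_ _ + _ _] := FG n; apply.
- by move=> x [n _ Fx]; exists n => //; have [_ _ _ + _] := FG n; apply.
Qed.

(** The sets with such approximations contain the open sets and are stable under complement and
    countable union, hence include the generated sigma-algebra. *)
Lemma closed_open_regular (A : set E) : measurable (A : set (borel E)) ->
  forall e : R, 0 < e -> exists F G : set E,
  [/\ closed F, open G, F `<=` A, A `<=` G & (mu (G `\` F) < e%:E)%E].
Proof.
move: A; apply: smallest_sub; last exact: reg_open.
split.
- by apply: reg_open; exact: open0.
- by move=> A rA; rewrite setTD; exact: reg_C.
- exact: reg_bigcup.
Qed.

End regularity.

Hypothesis complete_dist : forall u : nat -> E,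
  (forall e : R, 0 < e -> exists N : nat, forall m n : nat,
    (N <= m)%N -> (N <= n)%N -> dist (u m) (u n) < e) ->
  exists l : E, u @ \oo --> l.

Let ultra_bigcup (F : set_system E) (B : nat -> set E) n : UltraFilter F ->
  F (\bigcup_(i < n) B i) -> exists i, F (B i).
Proof.
move=> UF; elim: n => [|n IH FB].
  rewrite bigcup0 => [F0|i]; last by rewrite /= ltn0.
  by exfalso; exact: (filter_not_empty F).
have [FBn|FBn] := in_ultra_setVsetC (B n) UF; first by exists n.
apply: IH; apply: filterS (filterI FB FBn) => x [[i /= + Bix] Bnx].
rewrite ltnS leq_eqVlt => /orP[/eqP ?|ni]; first by subst i.
by exists i.
Qed.

(** An ultrafilter containing [K] contains, for each [k], one of the finitely many closed balls of
    radius [k.+1%:R^-1] that cover [K]. Points chosen in the successive finite intersections form a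
    Cauchy sequence, and the ultrafilter converges to its limit. *)
Lemma closed_totally_bounded_compact (K : set E) : closed K ->
  (forall k, exists n,
     K `<=` \bigcup_(i < n) [set y | dist (s i) y <= k.+1%:R^-1]) ->
  compact K.
Proof.
move=> cK tbK; rewrite compact_ultra => F UF FK.
have /choice[i FB] k : exists i, F [set y | dist (s i) y <= k.+1%:R^-1].
  have [n Kn] := tbK k.
  by apply: (@ultra_bigcup F (fun i => [set y | dist (s i) y <= k.+1%:R^-1]) n);
    apply: filterS FK.
have /choice[u uP] (n : nat) : exists y, forall k, (k <= n)%N ->
    dist (s (i k)) y <= k.+1%:R^-1.
  have : F [set y | forall k, (k <= n)%N -> dist (s (i k)) y <= k.+1%:R^-1].
    elim: n => [|n IH].
      by apply: filterS (FB 0%N) => y /= H k; rewrite leqn0 => /eqP ->.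
    apply: filterS (filterI IH (FB n.+1)) => y /= [H1 H2] k.
    by rewrite leq_eqVlt => /orP[/eqP ->//|]; rewrite ltnS; exact: H1.
  by move/filter_ex.
have inv_lt (e : R) : 0 < e -> exists k, k.+1%:R^-1 < e.
  by move=> e0; have [k] := ltr_add_invr e0; rewrite add0r; exists k.
have [l ul] : exists l : E, u @ \oo --> l.
  apply: complete_dist => e e0.
  have [|k ke] := inv_lt (e / 2); first by rewrite divr_gt0.
  exists k => m n km kn; have := dist_tri (u m) (s (i k)) (u n).
  rewrite [dist (u m) (s _)]distC; move: (uP m k km) (uP n k kn) ke.
  by move: (k.+1%:R^-1) => r; lra.
have il k : dist (s (i k)) l <= k.+1%:R^-1.
  have : closed [set y | dist (s (i k)) y <= k.+1%:R^-1].
    exact: closed_dist_le.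
  move/closed_cvg => /(_ _ \oo _ u _ l); apply=> //.
  by exists k => // n /= kn; exact: uP.
have Fl : F --> l.
  move=> A /nbhs_dist[e e0 lA].
  have [|k ke] := inv_lt (e / 2); first by rewrite divr_gt0.
  apply: filterS (FB k) => y /= ky; apply: lA => /=.
  have := dist_tri l (s (i k)) y; rewrite [dist l (s _)]distC.
  by move: (il k) ky ke; move: (k.+1%:R^-1) => r; lra.
exists l; split=> //.
apply: cK => A lA; have FA : F A := Fl A lA.
exact: (filter_ex (filterI FK FA)).
Qed.

(** Ulam's theorem: a closed inner approximation is intersected, for every [k], with a finite union
    of closed balls of radius [k.+1%:R^-1] carrying almost all the mass. The result is closed and
    totally bounded. *)
Lemma compact_inner_regular (mu : probability (borel E) R) (A : set E) :
  measurable (A : set (borel E)) ->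
  forall e : R, 0 < e -> exists K : set E,
  [/\ compact K, K `<=` A, measurable (K : set (borel E))
    & (mu (A `\` K) < e%:E)%E].
Proof.
move=> mA e e0.
have e2 k : 0 < e / 2 / (2 ^ k.+2)%:R by rewrite !divr_gt0// ltr0n expn_gt0.
have e20 : 0 < e / 2 by rewrite divr_gt0.
have [F [G [cF oG FA AG muGF]]] := closed_open_regular mu mA e20.
pose C k n := \bigcup_(i < n) [set y | dist (s i) y <= k.+1%:R^-1].
have cC k n : closed (C k n).
  by apply: closed_bigcup => [|i _]; [exact: finite_II|exact: closed_dist_le].
have mC k n : measurable (C k n : set (borel E)).
  exact: closed_measurable_borel.
(* The masses lost over all [k] sum to at most [e / 4]; with the loss below [e / 2] due to [F], the
   total stays below [e]. *)
have /choice[n Cn] k : exists n,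
    (mu (~` C k n) < (e / 2 / 2 / (2 ^ k.+1)%:R)%:E)%E.
  apply: probability_nonincreasing_lt => [n||].
  - exact: measurableC.
  - apply/nonincreasing_seqP => n; apply/subsetPset; apply: subsetC.
    by move=> y [i /= ni iy]; exists i => //=; exact: ltnW.
  - rewrite (_ : \bigcap_n _ = set0).
      by rewrite measure0 lte_fin !divr_gt0// ltr0n expn_gt0.
    rewrite -subset0 => x Cx.
    have [|m] := s_dense x (e := k.+1%:R^-1); first by rewrite invr_gt0.
    by move=> mx; have := Cx m.+1 I; apply; exists m => //=; exact: ltW.
pose K := F `&` \bigcap_k C k (n k).
have cK : closed K by apply: closedI => //; exact: closed_bigI.
exists K; split.
- apply: closed_totally_bounded_compact => // k; exists (n k).
  by move=> x [_ /(_ k I)].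
- by move=> x [Fx _]; exact: FA.
- exact: closed_measurable_borel.
- have mK := closed_measurable_borel cK.
  have mF := closed_measurable_borel cF.
  have mG := open_measurable_borel oG.
  have mCC : measurable (\bigcup_k (~` C k (n k)) : set (borel E)).
    by apply: bigcupT_measurable => k; exact: measurableC.
  apply: (@le_lt_trans _ _ (mu ((G `\` F) `|` \bigcup_k ~` C k (n k)))).
    apply: le_measure; rewrite ?inE.
    + exact: measurableD.
    + by apply: measurableU => //; exact: measurableD.
    + move=> x [Ax nKx]; have [Fx|nFx] := pselect (F x); last first.
        by left; split=> //; exact: AG.
      right; apply: contrapT => nCx; apply: nKx; split=> // k _.
      by apply: contrapT => nCkx; apply: nCx; exists k.
  apply: (le_lt_trans (measureU2 _ (measurableD mG mF) mCC)).
  rewrite (splitr e) EFinD; apply: lte_leD => //.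
    by rewrite fin_num_measure//; exact: bigcupT_measurable.
  apply: (@le_trans _ _ (\sum_(k <oo) mu (~` C k (n k)))%E).
    apply: (measure_sigma_subadditive mu) => //.
    by move=> k; exact: measurableC.
  apply: (@le_trans _ _ (e / 2 / 2)%:E); last by rewrite lee_fin; lra.
  apply: le_trans (epsilon_trick0 _ (ltW _)); last by rewrite !divr_gt0.
  by apply: lee_nneseries => // k _; exact: ltW.
Qed.

End polish.

Section polish_space.
Variables (R : realType) (E : ptopologicalType).
Hypothesis hE : polish_space R E.

Lemma polish_compact_inner_regular (mu : probability (borel E) R) (A : set E)
    (e : R) : measurable (A : set (borel E)) -> 0 < e ->
  exists K : set E, [/\ compact K, K `<=` A, measurable (K : set (borel E))
    & (mu (A `\` K) < e%:E)%E].
Proof.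
have [hD [dist [d0 dC dT dN dcomp]]] := hE.
have [s sd] := dense_sequence d0 dC dT dN hD.
by move=> mA; exact: (compact_inner_regular d0 dC dT dN sd dcomp).
Qed.

Lemma polish_open_outer_regular (mu : probability (borel E) R) (A : set E)
    (e : R) : measurable (A : set (borel E)) -> 0 < e ->
  exists G : set E, [/\ open G, A `<=` G & (mu (G `\` A) < e%:E)%E].
Proof.
have [hD [dist [d0 dC dT dN dcomp]]] := hE.
move=> mA e0; have [F [G [cF oG FA AG FG]]] :=
  closed_open_regular d0 dC dT dN mu mA e0.
exists G; split=> //; apply: le_lt_trans FG; apply: le_measure; rewrite ?inE.
- by apply: measurableD => //; exact: open_measurable_borel.
- apply: measurableD; [exact: open_measurable_borel|].
  exact: closed_measurable_borel.
- exact: setDS.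
Qed.

Lemma polish_open_bigcup_rectangles (G : set (E * E)) : open G ->
  exists U V : nat -> set E, (forall n, open (U n) /\ open (V n)) /\
    G = \bigcup_n (U n `*` V n).
Proof.
have [hD [dist [d0 dC dT dN dcomp]]] := hE.
have [s sd] := dense_sequence d0 dC dT dN hD.
pose B (p : nat * nat) := [set y | dist (s p.1) y < p.2.+1%:R^-1].
have oB p : open (B p) by exact: (open_dist_lt dT dN).
move=> oG.
(* [W] enumerates the pairs of basic balls; a code of no pair, or of a pair whose product leaves
   [G], yields the empty rectangle. *)
pose W n := if unpickle n is Some pq then
  if `[< B pq.1 `*` B pq.2 `<=` G >] then (B pq.1, B pq.2) else (set0, set0)
  else (set0, set0).
exists (fun n => (W n).1), (fun n => (W n).2); split=> [n|].
  rewrite /W; case: unpickle => [pq|] /=; last by split; exact: open0.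
  by case: ifP => _; split => //=; exact: open0.
apply/seteqP; split=> [[x y] Gxy|[x y] [n _]]; last first.
  rewrite /W; case: unpickle => [pq|]; last by move=> [].
  by case: ifPn => [/asboolP WG|_] [Bx By] //; apply: WG; split.
have [[/= A1 A2] [/= xA1 yA2] AG] : nbhs (x, y) G by exact: open_nbhs_nbhs.
have [n [k [Bx BA1]]] := countable_base dC dT dN sd xA1.
have [m [l [By BA2]]] := countable_base dC dT dN sd yA2.
exists (pickle ((n, k), (m, l))) => //; rewrite /W pickleK.
case: asboolP => // nBG; exfalso; apply: nBG => -[x' y'] [/= Bx' By'].
by apply: AG; split; [exact: BA1|exact: BA2].
Qed.

End polish_space.

(** * Kantorovich-Rubinstein potentials *)

Section lsc.
Variables (R : realType) (E : ptopologicalType) (c : E -> E -> R).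
Hypothesis hlsc : lsc_cost c.

Lemma lsc_cost_open (a : R) : open [set z : E * E | a < c z.1 z.2].
Proof.
by move/lower_semicontinuousP : hlsc; exact.
Qed.

(** The sigma-algebra is the product of the Borel ones, so openness of the superlevel sets is not
    enough by itself: they are split into countably many open rectangles. *)
Lemma lsc_cost_measurable (hE : polish_space R E) :
  measurable_fun setT (fun z : borel E * borel E => c z.1 z.2).
Proof.
apply: (measurability _ (RGenOInfty.measurableE R)).
move=> _ [_ [a ->] <-]; rewrite setTI.
have [U [V [oUV GE]]] :=
  polish_open_bigcup_rectangles hE (lsc_cost_open (a := a)).
rewrite (_ : _ @^-1` _ = [set z : E * E | a < c z.1 z.2]); last first.
  by apply/seteqP; split=> z /=; rewrite in_itv/= andbT.
rewrite GE; apply: bigcupT_measurable => n; have [oU oV] := oUV n.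
by apply: measurableX; exact: open_measurable_borel.
Qed.

(** The tube lemma: compactness of [K] turns neighbourhoods of the points [(x, y)] into one
    neighbourhood of [x]. *)
Lemma lsc_cost_open_forall (K : set E) (a : R) : compact K ->
  open [set x | forall y, K y -> a < c x y].
Proof.
move=> /compact_near_coveringP cK; rewrite openE => x /= Kx.
have := cK E (nbhs x) (fun x' y => a < c x' y) _; apply => y Ky.
have : nbhs (x, y) [set z : E * E | a < c z.1 z.2].
  by apply: open_nbhs_nbhs; split; [exact: lsc_cost_open|exact: Kx].
move=> [[A1 A2] [/= xA1 yA2] AG]; exists (A2, A1) => //= -[y' x'] [/= Ay Ax].
exact: (AG (x', y')).
Qed.

(** This is where the infimum of [c x] over [K] is at least [a]; it makes c-transforms over compact
    pieces measurable. *)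
Lemma lsc_cost_measurable_forall (K : set E) (a : R) : compact K ->
  measurable ([set x | forall y, K y -> a <= c x y] : set (borel E)).
Proof.
move=> cK.
rewrite (_ : mkset _ = \bigcap_n
    [set x | forall y, K y -> a - n.+1%:R^-1 < c x y]).
  apply: bigcapT_measurable => n; apply: open_measurable_borel.
  exact: lsc_cost_open_forall.
apply/seteqP; split=> [x H n _ y /H /=|x H y Ky].
  by apply: lt_le_trans; rewrite ltrBlDr ltrDl invr_gt0.
rewrite leNgt; apply/negP; rewrite -subr_gt0 => /ltr_add_invr[n].
rewrite add0r => nac; have := H n I y Ky; move: nac.
by move: (n.+1%:R^-1) => r; lra.
Qed.

End lsc.

(** * Bounded measurable functions and their integrals *)

Section bounded_measurable.
Context (R : realType) d (T : measurableType d).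
Implicit Types (f g : T -> R) (mu : probability T R).

Definition bounded_measurable f :=
  measurable_fun setT f /\ exists M : R, forall x, `|f x| <= M.

Lemma bounded_measurable_integrable mu f : bounded_measurable f ->
  mu.-integrable setT (EFin \o f).
Proof.
move=> [mf [M fM]]; apply: measurable_bounded_integrable => //.
  exact: le_lt_trans (probability_le1 _ _) (ltry _).
by exists M; split; rewrite ?num_real// => N MN x _; apply: le_trans (ltW MN).
Qed.

Lemma bounded_measurableD f g : bounded_measurable f -> bounded_measurable g ->
  bounded_measurable (fun x => f x + g x).
Proof.
move=> [mf [M fM]] [mg [N gN]]; split; first exact: measurable_funD.
by exists (M + N) => x; apply: le_trans (ler_normD _ _) (lerD (fM x) (gN x)).
Qed.

Lemma bounded_measurableZ (k : R) f : bounded_measurable f ->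
  bounded_measurable (fun x => k * f x).
Proof.
move=> [mf [M fM]]; split; first exact: measurable_funM.
by exists (`|k| * M) => x; rewrite normrM ler_wpM2l.
Qed.

Lemma bounded_measurable_cst (k : R) : bounded_measurable (fun _ => k).
Proof. by split=> //; exists `|k|. Qed.

Lemma bounded_measurable_indic (A : set T) : measurable A ->
  bounded_measurable (\1_A : T -> R).
Proof.
move=> mA; split; first exact: measurable_indic.
by exists 1 => x; rewrite indicE; case: (_ \in _); rewrite ?normr1 ?normr0.
Qed.

Lemma Rintegral_bounded_measurableD mu f g :
  bounded_measurable f -> bounded_measurable g ->
  \int[mu]_x (f x + g x) = \int[mu]_x f x + \int[mu]_x g x.
Proof.
by move=> bf bg; rewrite RintegralD//; exact: bounded_measurable_integrable.
Qed.

Lemma Rintegral_bounded_measurableZ mu (k : R) f : bounded_measurable f ->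
  \int[mu]_x (k * f x) = k * \int[mu]_x f x.
Proof.
by move=> bf; rewrite RintegralZl//; exact: bounded_measurable_integrable.
Qed.

Lemma le_Rintegral_bounded_measurable mu f g :
  bounded_measurable f -> bounded_measurable g ->
  (forall x, f x <= g x) -> \int[mu]_x f x <= \int[mu]_x g x.
Proof.
move=> bf bg fg.
by apply: le_Rintegral => //; exact: bounded_measurable_integrable.
Qed.

Lemma Rintegral_probability_cst mu (k : R) : \int[mu]_x k = k.
Proof. by rewrite Rintegral_cst// [X in fine X](probability_setT mu) mulr1. Qed.

Lemma Rintegral_indic_probability mu (A : set T) : measurable A ->
  \int[mu]_x \1_A x = fine (mu A).
Proof. by move=> mA; rewrite /Rintegral integral_indic// setIT. Qed.

End bounded_measurable.

Notation bounded_borel f := (@bounded_measurable _ _ (borel _) f).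

(** * From a pair of potentials to a single one *)

Section dual_bound.
Variables (R : realType) (E : ptopologicalType) (c : E -> E -> R).
Hypothesis hE : polish_space R E.
Hypothesis hc : quasi_pseudo_metric c.
Hypothesis hlsc : lsc_cost c.
Variables (mu nu : probability (borel E) R) (S : R).
Hypothesis HS : forall f : E -> R, bounded_borel f ->
  (forall x y, f x - f y <= c x y) ->
  \int[mu]_x f x - \int[nu]_x f x <= S.

Let c_ge0 x y : 0 <= c x y. Proof. by have [+ _ _] := hc; apply. Qed.
Let cxx x : c x x = 0. Proof. by have [_ + _] := hc; apply. Qed.
Let c_tri x y z : c x z <= c x y + c y z.
Proof. by have [_ _ +] := hc; apply. Qed.

(* [f] is the c-transform of the function equal to [a j] on [K j] for j < n,
   capped at [M]. *)
Lemma kantorovich_rubinstein_potential (M : R) (n : nat) (K : nat -> set E)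
    (a : nat -> R) : 0 <= M -> (forall j, (j < n)%N -> a j <= M) ->
  (forall j, compact (K j)) ->
  exists f : E -> R, [/\ bounded_borel f,
    (forall x y, f x - f y <= c x y),
    (forall x t, t <= M -> (forall j y, (j < n)%N -> K j y ->
       t <= c x y - a j) -> t <= f x),
    (forall x, f x <= M) &
    (forall j x, (j < n)%N -> K j x -> f x <= - a j)].
Proof.
move=> M0 aM cK.
(* The value [M] caps the infimum and keeps the set nonempty; [a j <= M] and [c >= 0] give the lower
   bound [- M]. *)
pose D x := [set t | t = M \/ exists j y,
  [/\ (j < n)%N, K j y & t = c x y - a j]].
have D0 x : D x !=set0 by exists M; left.
have DM x t : D x t -> - M <= t.
  move=> [->|[j [y [jn _ ->]]]]; first by lra.
  by have := aM j jn; have := c_ge0 x y; lra.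
have hD x : has_inf (D x) by split=> //; exists (- M) => t; exact: DM.
pose f x := inf (D x).
have fD x t : D x t -> f x <= t by move=> Dt; apply: (ge_inf (hD x).2).
have fM x : f x <= M by apply: fD; left.
have fMN x : - M <= f x by apply: lb_le_inf => // t; exact: DM.
have fge x t : t <= M -> (forall j y, (j < n)%N -> K j y ->
    t <= c x y - a j) -> t <= f x.
  move=> tM H; apply: lb_le_inf => // _ [->//|[j [y [jn Ky ->]]]]; exact: H.
exists f; split=> //.
- split; last by exists M => x; rewrite ler_norml fM fMN.
  apply: (measurability _ (RGenCInfty.measurableE R)).
  move=> _ [_ [b ->] <-]; rewrite setTI.
  have [bM|Mb] := leP b M; last first.
    rewrite (_ : _ @^-1` _ = set0)//; rewrite -subset0 => x /=.
    by rewrite in_itv/= andbT leNgt (le_lt_trans (fM x) Mb).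
  rewrite (_ : _ @^-1` _ = \bigcap_(j < n)
      [set x | forall y, K j y -> b + a j <= c x y]).
    apply: bigcap_measurableType => j _.
    exact: lsc_cost_measurable_forall.
  apply/seteqP; split=> x /=; rewrite in_itv/= andbT.
    move=> bf j jn y Ky; have : f x <= c x y - a j.
      by apply: fD; right; exists j, y.
    by move: bf; lra.
  move=> H; apply: fge => // j y jn Ky; rewrite lerBrDr; exact: (H j jn y Ky).
- move=> x y; rewrite lerBlDr -lerBlDl; apply: lb_le_inf => // t [->|].
    by have := fM x; have := c_ge0 x y; lra.
  (* By the triangle inequality, a competitor [z] for [f y] is also one for [f x], at an extra cost
     of at most [c x y]. *)
  move=> [j [z [jn Kz ->]]]; have := c_tri x y z.
  have : f x <= c x z - a j by apply: fD; right; exists j, z.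
  lra.
- move=> j x jn Kx; rewrite -[leRHS]add0r -(cxx x); apply: fD; right.
  by exists j, x.
Qed.

(** Let [f] be the potential built from compact pieces [K j] on which [psi] lies in
    [[a j, a j + d)]. Then [phi <= f] everywhere, [f <= d - psi] on the pieces, and off them
    [f + psi <= 2 * M], on a set of [nu]-mass at most [d']. The sum of integrals thus exceeds [S] by
    at most [2 * d = e]. *)
Lemma kantorovich_rubinstein_bound (phi psi : E -> R) :
  bounded_borel phi -> bounded_borel psi ->
  (forall x y, phi x + psi y <= c x y) ->
  \int[mu]_x phi x + \int[nu]_x psi x <= S.
Proof.
move=> bphi bpsi phipsi.
have [[mphi [M1 phiM]] [mpsi [M2 psiM]]] := (bphi, bpsi).
pose M := Num.max M1 M2.
have {}phiM x : `|phi x| <= M by rewrite le_max phiM.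
have {}psiM x : `|psi x| <= M by rewrite le_max psiM orbT.
have M0 : 0 <= M by apply: le_trans (phiM point).
apply/ler_addgt0Pr => e e0.
pose d := e / 2.
have d0 : 0 < d by rewrite divr_gt0.
(* The [n] levels of width [d] starting at [- M] cover [[- M, M]], while [a j <= M] still holds for
   [j < n]. *)
pose n := (Num.truncn (2 * M / d)).+1.
pose a (j : nat) := j%:R * d - M.
pose A (j : nat) := psi @^-1` `[a j, a j.+1[%classic.
have mA j : measurable (A j : set (borel E)).
  by rewrite -[A j]setTI; exact: mpsi.
(* This makes [2 * M * d' <= d]; the added 1 covers the case [M = 0]. *)
pose d' := d / (2 * M + 1).
have d'0 : 0 < d' by rewrite divr_gt0// ltr_wpDl// mulr_ge0.
have d'j j : 0 < d' / (2 ^ j.+1)%:R by rewrite divr_gt0// ltr0n expn_gt0.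
have /choice[K KP] j := polish_compact_inner_regular hE nu (mA j) (d'j j).
have M2d : 0 <= 2 * M / d by rewrite divr_ge0 ?mulr_ge0// ltW.
have A_cover x : exists2 j, (j < n)%N & A j x.
  have := psiM x; rewrite ler_norml => /andP[pM1 pM2].
  have pd0 : 0 <= (psi x + M) / d.
    by apply: divr_ge0; [move: pM1; lra|exact: ltW].
  exists (Num.truncn ((psi x + M) / d)).
    rewrite /n ltnS; apply: le_truncn; rewrite ler_wpM2r ?invr_ge0 ?(ltW d0)//.
    by move: pM2; lra.
  have /andP[] := truncn_itv pd0.
  rewrite /A/= in_itv/= /a ler_pdivlMr// ltr_pdivrMr// => H1 H2.
  by rewrite lerBlDr H1/= ltrBrDr.
have [j jn|j|f [bf flip fge fM fK]] :=
    @kantorovich_rubinstein_potential M n K a M0.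
- rewrite /a lerBlDr -ler_pdivlMr//.
  have -> : M + M = 2 * M by ring.
  by rewrite -(truncn_ge_nat _ M2d) -ltnS.
- by have [] := KP j.
have mK j : measurable (K j : set (borel E)) by have [] := KP j.
pose N := ~` \bigcup_(j < n) K j.
have mN : measurable (N : set (borel E)).
  by apply: measurableC; apply: bigcup_measurable => j _.
have nuN : (nu N <= d'%:E)%E.
  apply: le_trans (epsilon_trick0 xpredT (ltW d'0)).
  apply: (@le_trans _ _ (\sum_(j <oo) nu (A j `\` K j))%E).
    apply: (measure_sigma_subadditive nu) => //.
      by move=> j; exact: measurableD.
    move=> x Nx; have [j jn Ax] := A_cover x; exists j => //; split=> // Kx.
    by apply: Nx; exists j.
  by apply: lee_nneseries => // j _; apply: ltW; have [] := KP j.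
have {}nuN : fine (nu N) <= d'.
  have fN : nu N \is a fin_num by exact: fin_num_measure.
  by rewrite -lee_fin fineK.
have bpsi2 : bounded_borel (fun x => -1 * psi x) by exact: bounded_measurableZ.
have b1N : bounded_borel (\1_N : E -> R) by exact: bounded_measurable_indic.
have bMN : bounded_borel (fun x => 2 * M * \1_N x).
  exact: bounded_measurableZ.
have bd : bounded_borel (fun _ : E => d) by exact: bounded_measurable_cst.
have phif : \int[mu]_x phi x <= \int[mu]_x f x.
  apply: le_Rintegral_bounded_measurable => // x.
  apply: fge; first exact: le_trans (ler_norm _) (phiM x).
  move=> j y jn Ky; have [_ KA _ _] := KP j.
  have := KA y Ky; rewrite /A/= in_itv/= => /andP[+ _].
  by have := phipsi x y; lra.
have fpsi : \int[nu]_x f x <=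
    d + (- 1 * \int[nu]_x psi x + 2 * M * fine (nu N)).
  rewrite -(Rintegral_indic_probability nu mN).
  rewrite -(Rintegral_bounded_measurableZ nu (-1) bpsi).
  rewrite -(Rintegral_bounded_measurableZ nu (2 * M) b1N).
  rewrite -(Rintegral_bounded_measurableD nu bpsi2 bMN).
  rewrite -[X in _ <= X + _](Rintegral_probability_cst nu d).
  have bb := bounded_measurableD bpsi2 bMN.
  rewrite -(Rintegral_bounded_measurableD nu bd bb).
  have bdb := bounded_measurableD bd bb.
  apply: (le_Rintegral_bounded_measurable nu bf bdb) => x.
  rewrite indicE.
  have [/set_mem Nx|/negP xN] := boolP (x \in N).
    rewrite /= mulr1; move: (fM x) (psiM x); rewrite ler_norml => ? /andP[_ ?].
    by move: d0; lra.
  have [j /= jn Kx] : (\bigcup_(j < n) K j) x.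
    by apply: contrapT => Nx; apply: xN; rewrite inE.
  have := fK j x jn Kx; have [_ KA _ _] := KP j.
  have := KA x Kx; rewrite /A/= in_itv/= /a => /andP[_].
  by rewrite -natr1 /= mulr0; lra.
have fN0 : 0 <= fine (nu N) by exact: fine_ge0.
have MN : 2 * M * fine (nu N) <= d.
  have dd : d = (2 * M + 1) * d'.
    by rewrite /d' mulrCA divff ?mulr1// gt_eqF// ltr_wpDl// mulr_ge0.
  rewrite dd; apply: (@le_trans _ _ (2 * M * d')).
    by rewrite ler_wpM2l// mulr_ge0.
  by rewrite [leRHS]mulrDl mul1r lerDl ltW.
have := HS bf flip; move: phif fpsi MN; rewrite /d; lra.
Qed.

End dual_bound.

(** * The sublinear functional and its additive minorant *)

Section functional.
Variables (R : realType) (E : ptopologicalType) (c : E -> E -> R).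
Variables (mu nu : probability (borel E) R) (S : R).
Hypothesis hdual : forall phi psi : E -> R,
  bounded_borel phi -> bounded_borel psi ->
  (forall x y, phi x + psi y <= c x y) ->
  \int[mu]_x phi x + \int[nu]_x psi x <= S.

Let bounded : set (E * E -> R) :=
  [set u | exists M : R, forall z, `|u z| <= M].

(** An upper bound for [u] is priced with [phi] integrated by [mu], [psi] by [nu], and [c] charged
    at [S]. The factor [r] is strictly positive so that it can be divided out. *)
Let feasible (u : E * E -> R) : set R :=
  [set t | exists (phi psi : E -> R) (r : R),
     [/\ bounded_borel phi, bounded_borel psi, 0 < r,
     (forall z, u z <= phi z.1 + psi z.2 + r * c z.1 z.2) &
     t = \int[mu]_x phi x + \int[nu]_x psi x + r * S]].

(** Dividing [- M <= phi x + psi y + r * c x y] by [r] shows that [- (phi + M) / r] and [- psi / r]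
    are admissible in [hdual], whose conclusion rearranges to the bound. *)
Let feasible_ge u t (M : R) :
  (forall z, `|u z| <= M) -> feasible u t -> - M <= t.
Proof.
move=> uM [phi [psi [r [bphi bpsi r0 ule ->]]]].
have bpsi' : bounded_borel (fun x => - r^-1 * psi x).
  exact: bounded_measurableZ.
have bphi' : bounded_borel (fun x => - r^-1 * phi x).
  exact: bounded_measurableZ.
have bM : bounded_borel (fun _ : E => - r^-1 * M).
  exact: bounded_measurable_cst.
have bphiM := bounded_measurableD bphi' bM.
have H : \int[mu]_x (- r^-1 * phi x + - r^-1 * M) +
    \int[nu]_x (- r^-1 * psi x) <= S.
  apply: hdual => // x y; rewrite -!mulrDr mulNr lerNl -(ler_pM2l r0).
  rewrite mulVKf ?gt_eqF//; have := ule (x, y); have := uM (x, y).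
  by rewrite ler_norml => /andP[+ _] /=; lra.
move: H; rewrite (Rintegral_bounded_measurableD mu bphi' bM).
rewrite (Rintegral_bounded_measurableZ mu _ bphi).
rewrite (Rintegral_bounded_measurableZ nu _ bpsi).
rewrite (Rintegral_probability_cst mu) -!mulrDr mulNr lerNl -(ler_pM2l r0).
by rewrite mulVKf ?gt_eqF//; lra.
Qed.

Let feasible_ub u (M : R) :
  (forall z, `|u z| <= M) -> (forall x y, 0 <= c x y) ->
  feasible u (M + S).
Proof.
move=> uM c0; exists (fun _ => M), (fun _ => 0), 1; split.
- exact: bounded_measurable_cst.
- exact: bounded_measurable_cst.
- by [].
- move=> z; have := uM z; have := c0 z.1 z.2.
  by rewrite ler_norml => + /andP[]; lra.
- by rewrite (Rintegral_probability_cst mu) (Rintegral_probability_cst nu); lra.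
Qed.

Let feasibleD u v t s : feasible u t -> feasible v s ->
  feasible (u + v) (t + s).
Proof.
move=> [phi [psi [r [bphi bpsi r0 ule ->]]]].
move=> [phi' [psi' [r' [bphi' bpsi' r'0 vle ->]]]].
exists (fun x => phi x + phi' x), (fun x => psi x + psi' x), (r + r'); split.
- exact: bounded_measurableD.
- exact: bounded_measurableD.
- exact: addr_gt0.
- move=> z; rewrite -[(u + v) z]/(u z + v z) mulrDl /=.
  by have := ule z; have := vle z; lra.
- rewrite (Rintegral_bounded_measurableD mu bphi bphi').
  by rewrite (Rintegral_bounded_measurableD nu bpsi bpsi'); lra.
Qed.

Let feasibleZ (k : R) u v t : 0 < k -> (forall z, v z = k * u z) ->
  feasible u t -> feasible v (k * t).
Proof.
move=> k0 vu [phi [psi [r [bphi bpsi r0 ule ->]]]].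
exists (fun x => k * phi x), (fun x => k * psi x), (k * r); split.
- exact: bounded_measurableZ.
- exact: bounded_measurableZ.
- exact: mulr_gt0.
- by move=> z; rewrite vu -mulrA -!mulrDr ler_pM2l.
- rewrite (Rintegral_bounded_measurableZ mu k bphi).
  by rewrite (Rintegral_bounded_measurableZ nu k bpsi); ring.
Qed.

(** The two bounds on feasible values make their infimum [p] a real-valued sublinear functional on
    bounded functions; [L] is an additive minorant of it. *)
Lemma kantorovich_rubinstein_functional : (forall x y, 0 <= c x y) ->
  exists L : (E * E -> R) -> R,
    (forall u v, bounded u -> bounded v -> L (u + v) = L u + L v) /\
    (forall u (phi psi : E -> R) (r : R),
      bounded u -> bounded_borel phi -> bounded_borel psi -> 0 < r ->
      (forall z, u z <= phi z.1 + psi z.2 + r * c z.1 z.2) ->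
      L u <= \int[mu]_x phi x + \int[nu]_x psi x + r * S).
Proof.
move=> c0.
have bB u v : bounded u -> bounded v -> bounded (u - v).
  move=> [M uM] [N vN]; exists (M + N) => z.
  exact: le_trans (ler_normB _ _) (lerD (uM z) (vN z)).
have b0 : bounded 0 by exists 0 => z; rewrite normr0.
have bD u v : bounded u -> bounded v -> bounded (u + v).
  move=> [M uM] [N vN]; exists (M + N) => z.
  exact: le_trans (ler_normD _ _) (lerD (uM z) (vN z)).
have bMn u n : bounded u -> bounded (u *+ n).
  by move=> bu; elim: n => [|n IH]; rewrite ?mulrS//; exact: bD.
pose p u := inf (feasible u).
have f0 u : bounded u -> feasible u !=set0.
  by move=> [M uM]; exists (M + S); exact: feasible_ub.
have ple u t : bounded u -> feasible u t -> p u <= t.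
  move=> [M uM] ut; apply: ge_inf => //; exists (- M) => s.
  exact: feasible_ge.
have p0 : p 0 = 0.
  apply/eqP; rewrite eq_le; apply/andP; split; last first.
    apply: lb_le_inf; first exact: f0.
    move=> t /(@feasible_ge _ _ 0); rewrite oppr0; apply => z.
    by rewrite normr0.
  (* As [r] must be positive, the zero function is dominated by [r * c] with [r = e / (S + 1)],
     priced at most [e]; zero potentials in [hdual] give [S >= 0]. *)
  apply/ler_addgt0Pr => e e0; rewrite add0r.
  have S0 : 0 <= S.
    have b00 : bounded_borel (fun _ : E => 0 : R).
      exact: bounded_measurable_cst.
    have : \int[mu]_x (fun _ : E => 0 : R) x +
        \int[nu]_x (fun _ : E => 0 : R) x <= S.
      by apply: hdual => // x y /=; rewrite addr0.
    rewrite (Rintegral_probability_cst mu) (Rintegral_probability_cst nu).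
    by rewrite addr0.
  have r0 : 0 < e / (S + 1) by rewrite divr_gt0// ltr_wpDl.
  apply: (@le_trans _ _ (e / (S + 1) * S)).
    apply: ple => //.
    exists (fun _ => 0), (fun _ => 0), (e / (S + 1)); split=> //.
    - exact: bounded_measurable_cst.
    - exact: bounded_measurable_cst.
    - by move=> z; rewrite !add0r; apply: mulr_ge0 => //; exact: ltW.
    - rewrite (Rintegral_probability_cst mu) (Rintegral_probability_cst nu).
      by rewrite !add0r.
  rewrite mulrAC -mulrA ler_piMr ?(ltW e0)// ler_pdivrMr ?ltr_wpDl//.
  by rewrite mul1r lerDl.
have sp : nat_sublinear bounded p.
  have pD u v : bounded u -> bounded v -> p (u + v) <= p u + p v.
    move=> bu bv; rewrite -lerBlDr; apply: lb_le_inf; first exact: f0.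
    move=> t ut; rewrite lerBlDr -lerBlDl; apply: lb_le_inf; first exact: f0.
    move=> s vs; rewrite lerBlDl; apply: ple; first exact: bD.
    exact: feasibleD.
  split=> // -[|n] u bu; first by rewrite !mulr0n p0.
  have n0 : 0 < n.+1%:R :> R by rewrite ltr0n.
  have uE z : (u *+ n.+1) z = n.+1%:R * u z.
    by rewrite mulr_natl natmulfctE.
  rewrite -[p u *+ _]mulr_natl; apply/eqP; rewrite eq_le; apply/andP; split.
    rewrite -ler_pdivrMl//; apply: lb_le_inf; first exact: f0.
    move=> t ut; rewrite ler_pdivrMl//; apply: ple; first exact: bMn.
    exact: feasibleZ ut.
  apply: lb_le_inf; first by apply: f0; exact: bMn.
  move=> t ut; rewrite -ler_pdivlMl//; apply: ple => //.
  apply: feasibleZ ut; first by rewrite invr_gt0.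
  by move=> z; rewrite uE mulKf// gt_eqF.
have [L [Lp LD]] := exists_additive_minorant bB b0 sp.
exists L; split=> // u phi psi r bu bphi bpsi r0 ule.
by apply: le_trans (Lp u bu) _; apply: ple => //; exists phi, psi, r.
Qed.

End functional.

(** * Measures on products from measurable rectangles *)

Section rectangles.
Context d1 d2 (T1 : measurableType d1) (T2 : measurableType d2).

(* An alias of the product carrying the semiring of measurable rectangles
   instead of the product sigma-algebra. *)
Definition rectangles : Type := (T1 * T2)%type.

HB.instance Definition _ := Pointed.on rectangles.

Definition measurable_rectangle : set (set rectangles) :=
  [set A `*` B | A in measurable & B in measurable].

Let rectangle0 : measurable_rectangle set0.
Proof. by exists set0 => //; exists set0 => //; rewrite setX0. Qed.

Let rectangleI : setI_closed measurable_rectangle.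
Proof.
move=> _ _ [A mA [B mB <-]] [A' mA' [B' mB' <-]].
exists (A `&` A'); first exact: measurableI.
exists (B `&` B'); first exact: measurableI.
by rewrite setXI.
Qed.

Let rectangleD : semi_setD_closed measurable_rectangle.
Proof.
move=> _ _ [A mA [B mB <-]] [A' mA' [B' mB' <-]].
exists [set (A `\` A') `*` B; (A `&` A') `*` (B `\` B')]; split.
- exact: finite_set2.
- move=> X [->|->].
    by exists (A `\` A'); [exact: measurableD|exists B].
  exists (A `&` A'); first exact: measurableI.
  by exists (B `\` B') => //; exact: measurableD.
- rewrite bigcup_setU !bigcup_set1; apply/seteqP; split=> [[x y]|[x y]] /=.
    move=> [[Ax By] nA'B']; have [A'x|nA'x] := pselect (A' x).
      by right; split=> //; split=> // B'y; apply: nA'B'.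
    by left.
  by move=> [[[Ax nA'x] By]|[[Ax A'x] [By nB'y]]]; split=> // -[].
- move=> X Y [->|->] [->|->] //= [[x y]].
    by move=> [[[_ nA'x] _] [[_ A'x] _]].
  by move=> [[[_ A'x] _] [[_ nA'x] _]].
Qed.

HB.instance Definition _ := isSemiRingOfSets.Build ((d1, d2).-prod)%mdisp
  rectangles rectangle0 rectangleI rectangleD.

(** Caratheodory extension. It lives on the sigma-algebra generated by the rectangles, which is the
    product one, and is then repackaged on the product type. *)
Lemma measure_of_rectangles (R : realType) (m : set (T1 * T2) -> \bar R) :
  (forall A, (0 <= m A)%E) ->
  @measure_function.semi_additive _ R rectangles m ->
  @measurable_subset_sigma_subadditive _ R rectangles m ->
  m setT = 1%E ->
  exists Q : probability (T1 * T2)%type R,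
    forall A B, measurable A -> measurable B -> Q (A `*` B) = m (A `*` B).
Proof.
move=> m_ge0 m_add m_sub mT.
pose cm : {content set rectangles -> \bar R} :=
  HB.pack (m : set rectangles -> \bar R)
    (isContent.Build _ rectangles R m m_ge0 m_add).
pose mm : {measure set rectangles -> \bar R} :=
  HB.pack (m : set rectangles -> \bar R) (Content.class cm)
    (Content_SigmaSubAdditive_isMeasure.Build _ R rectangles cm m_sub).
pose q : set (T1 * T2) -> \bar R := measure_extension mm.
have qE (A : set T1) (B : set T2) : measurable A -> measurable B ->
    q (A `*` B) = m (A `*` B).
  move=> mA mB; apply: (measurable_mu_extE mm).
  by exists A => //; exists B.
have q0 : q set0 = 0 by exact: (measure0 (measure_extension mm)).
have q_ge0 A : (0 <= q A)%E by exact: (measure_ge0 (measure_extension mm)).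
have q_add : @semi_sigma_additive _ R (T1 * T2)%type q.
  move=> F mF tF mUF.
  have eqM : @measurable _ (T1 * T2)%type =
      <<s (@measurable _ rectangles) >>.
    exact: measurable_prod_measurableType.
  apply: (@measure_semi_sigma_additive _ _ _ (measure_extension mm)) => //.
    by move=> i; have := mF i; rewrite eqM.
  by rewrite eqM in mUF.
have qT : q setT = 1%E by rewrite -setXTT qE// setXTT.
pose Q0 : {measure set (T1 * T2)%type -> \bar R} :=
  HB.pack q (isMeasure.Build _ (T1 * T2)%type R q q0 q_ge0 q_add).
pose Q : probability (T1 * T2)%type R :=
  HB.pack q (Measure.class Q0) (Measure_isProbability.Build _ _ R Q0 qT).
by exists Q.
Qed.

End rectangles.

(** * Discrete layer-cake bounds *)

Section layer_cake.
Variable R : realType.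

Let count (x : R) (m : nat) : R := \sum_(j < m) ((j.+1%:R < x)%R)%:R.

Let count_le (x : R) (m : nat) : count x m <= m%:R.
Proof.
rewrite /count -[X in _ <= X%:R]card_ord -sum1_card natr_sum.
by apply: ler_sum => i _; case: (_ < _).
Qed.

(** The sum counts the integers among 1, ..., [m] lying strictly below [x], a discrete layer-cake
    integral of [x]. *)
Lemma sum_lt_nat_le (x : R) (m : nat) : 0 <= x ->
  \sum_(j < m) ((j.+1%:R < x)%R)%:R <= x.
Proof.
move=> x0; elim: m => [|m IH]; first by rewrite big_ord0.
rewrite big_ord_recr/=; case: ltP => [mx|_]; last by rewrite addr0.
by apply: le_trans (ltW mx); rewrite -natr1 lerD2r; exact: count_le.
Qed.

(** The count thus determines the truncation of [x] at [m] up to 1; once [c] is scaled by [N.+1],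
    this error becomes [N.+1%:R^-1]. *)
Lemma sum_lt_nat_ge (x : R) (m : nat) :
  Num.min x m%:R <= \sum_(j < m) ((j.+1%:R < x)%R)%:R + 1.
Proof.
have countE n : n%:R < x -> count x n = n%:R.
  move=> nx; rewrite /count -[X in _ = X%:R]card_ord -sum1_card natr_sum.
  apply: eq_bigr => i _; rewrite (le_lt_trans _ nx)//= ler_nat.
  exact: ltn_ord.
rewrite -/(count x m); elim: m => [|m IH].
  by rewrite /count big_ord0 ge_min add0r ler01 orbT.
rewrite /count big_ord_recr/= -/(count x m).
have [mx|xm] := ltP (m.+1%:R) x.
  rewrite countE//; last first.
    by apply: le_lt_trans mx; rewrite ler_nat.
  by rewrite natr1 lerDl.
rewrite addr0; have [xm'|mx] := leP x m%:R.
  by move: IH; rewrite min_l.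
by rewrite countE// natr1.
Qed.

End layer_cake.

Section truncation.
Context (R : realType) d (T : measurableType d).

Lemma Rintegral_sum_indic (Q : probability T R) (G : nat -> set T) (n : nat) :
  (forall j, measurable (G j)) ->
  bounded_measurable (fun x => \sum_(j < n) \1_(G j) x : R) /\
  \int[Q]_x (\sum_(j < n) \1_(G j) x) = \sum_(j < n) fine (Q (G j)).
Proof.
move=> mG; elim: n => [|n [IH1 IH2]].
  have -> : (fun x => \sum_(j < 0) \1_(G j) x : R) = fun _ => 0.
    by apply/funext => x; rewrite big_ord0.
  rewrite big_ord0; split; first exact: bounded_measurable_cst.
  by rewrite Rintegral_probability_cst.
have -> : (fun x => \sum_(j < n.+1) \1_(G j) x : R) =
    fun x => \sum_(j < n) \1_(G j) x + \1_(G n) x.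
  by apply/funext => x; rewrite big_ord_recr.
have b1 : bounded_measurable (\1_(G n) : T -> R).
  exact: bounded_measurable_indic.
split; first exact: bounded_measurableD.
rewrite Rintegral_bounded_measurableD// IH2 big_ord_recr/=.
by rewrite Rintegral_indic_probability.
Qed.

(** Monotone convergence along the truncations, which are eventually constant at each point. *)
Lemma ge0_integral_le_truncation (Q : {measure set T -> \bar R}) (f : T -> R)
    (b : \bar R) :
  measurable_fun setT f -> (forall x, 0 <= f x) ->
  (forall n, (\int[Q]_x (Num.min (f x) n.+1%:R)%:E <= b)%E) ->
  (\int[Q]_x (f x)%:E <= b)%E.
Proof.
move=> mf f0 fb.
pose g n x := (Num.min (f x) n.+1%:R)%:E.
have fE x : limn (g^~ x) = (f x)%:E.
  apply/cvg_lim => //; apply: cvg_near_cst.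
  exists (Num.truncn (f x)) => // n /= fn; rewrite /g min_l//.
  apply: ltW; apply: lt_le_trans (truncnS_gt _) _.
  by rewrite ler_nat ltnS.
have gcvg : (\int[Q]_x g n x)%E @[n --> \oo] -->
    (\int[Q]_x (fun x => limn (g^~ x)) x)%E.
  apply: cvg_monotone_convergence => //.
  - move=> n; apply/measurable_EFinP; exact: measurable_minr.
  - by move=> n x _; rewrite lee_fin le_min f0 ler0n.
  - move=> x _ m n mn; rewrite lee_fin le_min ge_min lexx/=.
    by rewrite ge_min ler_nat ltnS mn orbT.
have -> : (\int[Q]_x (f x)%:E = \int[Q]_x (fun x => limn (g^~ x)) x)%E.
  by apply: eq_integral => x _; rewrite fE.
rewrite -(cvg_lim _ gcvg)//; apply: lime_le.
  by apply/cvg_ex; eexists; exact: gcvg.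
by apply: nearW => n; exact: fb.
Qed.

End truncation.

(** * The coupling *)

Section coupling.
Variables (R : realType) (E : ptopologicalType) (c : E -> E -> R).
Hypothesis hE : polish_space R E.
Hypothesis hlsc : lsc_cost c.
Hypothesis c0 : forall x y, 0 <= c x y.
Variables (mu nu : probability (borel E) R) (S : R).

Let bounded : set (E * E -> R) :=
  [set u | exists M : R, forall z, `|u z| <= M].

Variable L : (E * E -> R) -> R.
Hypothesis LD : forall u v, bounded u -> bounded v -> L (u + v) = L u + L v.
Hypothesis Lle : forall u (phi psi : E -> R) (r : R), bounded u ->
  bounded_borel phi -> bounded_borel psi -> 0 < r ->
  (forall z, u z <= phi z.1 + psi z.2 + r * c z.1 z.2) ->
  L u <= \int[mu]_x phi x + \int[nu]_x psi x + r * S.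

Let boundedD u v : bounded u -> bounded v -> bounded (u + v).
Proof.
move=> [M uM] [N vN]; exists (M + N) => z.
exact: le_trans (ler_normD _ _) (lerD (uM z) (vN z)).
Qed.

Let boundedN u : bounded u -> bounded (- u).
Proof. by move=> [M uM]; exists M => z; rewrite normrN. Qed.

Let bounded1 (A : set (E * E)) : bounded \1_A.
Proof.
by exists 1 => z; rewrite indicE; case: (_ \in _); rewrite ?normr1 ?normr0.
Qed.

Let bounded_sum (I : Type) (s : seq I) (F : I -> set (E * E)) :
  bounded (\sum_(i <- s) \1_(F i)).
Proof.
elim/big_ind: _ => [|u v bu bv|//]; last exact: boundedD.
by exists 0 => z; rewrite normr0.
Qed.

Let L0 : L 0 = 0.
Proof.
have b0 : bounded 0 by exists 0 => z; rewrite normr0.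
by apply: (addrI (L 0)); rewrite -LD// !addr0.
Qed.

Let LN u : bounded u -> L (- u) = - L u.
Proof.
move=> bu; apply/eqP; rewrite -subr_eq0 opprK -LD//; last exact: boundedN.
by rewrite addNr L0.
Qed.

(** Letting [r] tend to 0 in [Lle] removes the cost; the choice [e / (|S| + 1)] keeps [r * S] at
    most [e] whatever the sign of [S]. *)
Let L_marginals u (phi psi : E -> R) : bounded u -> bounded_borel phi ->
  bounded_borel psi -> (forall z, u z <= phi z.1 + psi z.2) ->
  L u <= \int[mu]_x phi x + \int[nu]_x psi x.
Proof.
move=> bu bphi bpsi ule; apply/ler_addgt0Pr => e e0.
have S1 : 0 < `|S| + 1 by rewrite ltr_wpDl.
have r0 : 0 < e / (`|S| + 1) by rewrite divr_gt0.
apply: (@le_trans _ _ (\int[mu]_x phi x + \int[nu]_x psi x +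
    e / (`|S| + 1) * S)).
  apply: Lle => // z; apply: le_trans (ule z) _; rewrite lerDl.
  by apply: mulr_ge0 => //; exact: ltW.
rewrite lerD2l; apply: le_trans (ler_norm _) _; rewrite normrM.
rewrite (gtr0_norm r0) mulrAC ler_pdivrMr// ler_pM2l// lerDl//.
Qed.

Let L_mono u v : bounded u -> bounded v -> (forall z, u z <= v z) -> L u <= L v.
Proof.
move=> bu bv uv; rewrite -subr_ge0 -(LN bu) -LD//; last exact: boundedN.
have bvu : bounded (u - v) by apply: boundedD => //; exact: boundedN.
have -> : v - u = - (u - v) by rewrite opprB.
rewrite LN// oppr_ge0.
have b00 : bounded_borel (fun _ : E => 0 : R) by exact: bounded_measurable_cst.
have := L_marginals bvu b00 b00.
rewrite (Rintegral_probability_cst mu) (Rintegral_probability_cst nu) addr0.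
by apply => z; rewrite /= ?addr0 -[(u - v) z]/(u z - v z) subr_le0.
Qed.

Let L_sum (I : Type) (s : seq I) (F : I -> set (E * E)) :
  L (\sum_(i <- s) \1_(F i)) = \sum_(i <- s) L \1_(F i).
Proof.
elim: s => [|i s IH]; first by rewrite !big_nil.
by rewrite !big_cons LD// IH.
Qed.

Let L_indic_ge0 A : 0 <= L \1_A.
Proof.
by rewrite -L0; apply: L_mono => //; exists 0 => z; rewrite normr0.
Qed.

Let L_indicU (A B : set (E * E)) : A `&` B = set0 ->
  L \1_(A `|` B) = L \1_A + L \1_B.
Proof.
move=> AB; rewrite -LD//; congr L; apply/funext => z.
rewrite -[RHS]/(\1_A z + \1_B z) !indicE in_setU.
case: (boolP (z \in A)) => [/set_mem Az|_]; last by rewrite add0r.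
case: (boolP (z \in B)) => [/set_mem Bz|_]; last by rewrite addr0.
by exfalso; have : set0 z by rewrite -AB.
Qed.

(** Domination is applied to the indicator with potential 1 and to its opposite with potential
    -1. *)
Let L_indicT : L \1_setT = 1.
Proof.
have bT : bounded (- \1_setT) by exact: boundedN.
apply/eqP; rewrite eq_le; apply/andP; split.
  have b1 : bounded_borel (fun _ : E => 1 : R) by exact: bounded_measurable_cst.
  have b0 : bounded_borel (fun _ : E => 0 : R) by exact: bounded_measurable_cst.
  have := L_marginals (bounded1 setT) b1 b0.
  rewrite (Rintegral_probability_cst mu) (Rintegral_probability_cst nu) addr0.
  by apply => z; rewrite /= ?addr0 indicE in_setT.
have b1 : bounded_borel (fun _ : E => -1 : R) by exact: bounded_measurable_cst.
have b0 : bounded_borel (fun _ : E => 0 : R) by exact: bounded_measurable_cst.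
have := L_marginals bT b1 b0.
rewrite (Rintegral_probability_cst mu) (Rintegral_probability_cst nu) addr0.
rewrite LN// lerN2; apply => z.
by rewrite /= ?addr0 -[(- \1_setT) z]/(- \1_setT z) indicE in_setT.
Qed.

Let L_indicl_le (A : set E) : measurable (A : set (borel E)) ->
  L \1_(A `*` setT) <= fine (mu A).
Proof.
move=> mA.
have bA : bounded_borel (\1_A : E -> R) by exact: bounded_measurable_indic.
have b0 : bounded_borel (fun _ : E => 0 : R) by exact: bounded_measurable_cst.
have := L_marginals (bounded1 (A `*` setT)) bA b0.
rewrite (Rintegral_indic_probability mu mA) (Rintegral_probability_cst nu).
rewrite addr0.
by apply => -[x y] /=; rewrite ?addr0 !indicE in_setX in_setT andbT.
Qed.

Let L_indicr_le (A : set E) : measurable (A : set (borel E)) ->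
  L \1_(setT `*` A) <= fine (nu A).
Proof.
move=> mA.
have bA : bounded_borel (\1_A : E -> R) by exact: bounded_measurable_indic.
have b0 : bounded_borel (fun _ : E => 0 : R) by exact: bounded_measurable_cst.
have := L_marginals (bounded1 (setT `*` A)) b0 bA.
rewrite (Rintegral_indic_probability nu mA) (Rintegral_probability_cst mu).
rewrite add0r.
by apply => -[x y] /=; rewrite ?add0r !indicE in_setX in_setT.
Qed.

Let fine_setC (p : probability (borel E) R) (A : set E) :
  measurable (A : set (borel E)) -> fine (p (~` A)) = 1 - fine (p A).
Proof.
move=> mA; rewrite (probability_setC p mA).
by rewrite fineB//; exact: fin_num_measure.
Qed.

(** The upper bounds for [A] and for its complement add up to 1, as do the values of [L], so both
    are equalities. *)
Let L_indicl (A : set E) : measurable (A : set (borel E)) ->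
  L \1_(A `*` setT) = fine (mu A).
Proof.
move=> mA; apply/eqP; rewrite eq_le L_indicl_le//=.
have := L_indicl_le (measurableC mA); rewrite fine_setC//.
have := L_indicT.
have -> : setT = (A `*` setT) `|` (~` A `*` setT) :> set (E * E).
  apply/seteqP; split=> // -[x y] _.
  by have [Ax|nAx] := pselect (A x); [left|right].
rewrite L_indicU; last by rewrite -subset0 => -[x y] [[Ax _] [nAx _]].
by move: (L _) (L _) => a b; lra.
Qed.

Let L_indicr (A : set E) : measurable (A : set (borel E)) ->
  L \1_(setT `*` A) = fine (nu A).
Proof.
move=> mA; apply/eqP; rewrite eq_le L_indicr_le//=.
have := L_indicr_le (measurableC mA); rewrite fine_setC//.
have := L_indicT.
have -> : setT = (setT `*` A) `|` (setT `*` ~` A) :> set (E * E).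
  apply/seteqP; split=> // -[x y] _.
  by have [Ay|nAy] := pselect (A y); [left|right].
rewrite L_indicU; last by rewrite -subset0 => -[x y] [[_ Ay] [_ nAy]].
by move: (L _) (L _) => a b; lra.
Qed.

Let m (X : set (E * E)) : \bar R := (L \1_X)%:E.

Let rects : Type := rectangles (borel E) (borel E).

Let m_add : @measure_function.semi_additive _ R rects m.
Proof.
move=> F n _ tF _; rewrite /m sumEFin; congr EFin.
elim: n => [|n IH]; first by rewrite !big_ord0 indic0 L0.
rewrite !big_ord_recr/= L_indicU ?IH//.
rewrite -bigcup_mkord -subset0 => z [[i /= ni Fi] Fn].
have := tF i n I I; move=> H; have : i = n by apply: H; exists z.
by move=> ein; rewrite ein ltnn in ni.
Qed.

(** A point of the large rectangle outside the small one has a coordinate in one of the two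
    differences, and the strips over these are weighed by the marginals. *)
Let L_setD (A A' B B' : set E) : measurable (A : set (borel E)) ->
  measurable (B : set (borel E)) -> measurable (A' : set (borel E)) ->
  measurable (B' : set (borel E)) -> A' `<=` A -> B' `<=` B ->
  L \1_(A `*` B) <=
  L \1_(A' `*` B') + fine (mu (A `\` A')) + fine (nu (B `\` B')).
Proof.
move=> mA mB mA' mB' A'A B'B.
rewrite -(L_indicl (measurableD mA mA')) -(L_indicr (measurableD mB mB')).
rewrite -!LD//; last exact: boundedD.
apply: L_mono => //; first by apply: boundedD => //; exact: boundedD.
move=> [x y].
rewrite -[leRHS]/(\1_(A' `*` B') (x, y) + \1_((A `\` A') `*` setT) (x, y) +
  \1_(setT `*` (B `\` B')) (x, y)).
rewrite !indicE; have [/set_mem[/= Ax By]|_] := boolP ((x, y) \in A `*` B).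
  have [A'x|nA'x] := pselect (A' x); last first.
    have -> : (x, y) \in (A `\` A') `*` setT by exact: mem_set.
    by rewrite addrAC lerDr addr_ge0 // ler0n.
  have [B'y|nB'y] := pselect (B' y); last first.
    have -> : (x, y) \in setT `*` (B `\` B') by exact: mem_set.
    by rewrite lerDr addr_ge0 // ler0n.
  have -> : (x, y) \in A' `*` B' by exact: mem_set.
  by rewrite -addrA lerDl addr_ge0 // ler0n.
by rewrite !addr_ge0 // ler0n.
Qed.

Let compact_rectangles_cover (K K' : set E) (U V : nat -> set E) :
  compact K -> compact K' -> (forall n, open (U n)) -> (forall n, open (V n)) ->
  K `*` K' `<=` \bigcup_n (U n `*` V n) ->
  exists N, K `*` K' `<=` \bigcup_(n < N) (U n `*` V n).
Proof.
move=> cK cK' oU oV KUV.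
have /compact_near_coveringP cKK := compact_setX cK cK'.
(* In the near-covering form of compactness along [\oo], each point is covered, together with a
   neighbourhood, for all large [N]; hence one [N] serves the whole product. *)
have := cKK nat \oo (fun N z => (\bigcup_(n < N) (U n `*` V n)) z) _.
case=> [z /KUV[n _ [Uz Vz]]|N _ HN]; last by exists N; exact: (HN N (leqnn N)).
exists ((U n `*` V n), [set N | (n < N)%N]).
  split=> /=; last by exists n.+1.
  case: z Uz Vz => x y /= Ux Vy; exists (U n, V n) => //.
  by split=> /=; apply: open_nbhs_nbhs.
by move=> [z' N] [/= [Uz' Vz'] nN]; exists n.
Qed.

(** [X] is shrunk to a compact rectangle at cost [e / 2], and the [F n] are enlarged to open
    rectangles at costs summing to [e / 2]. Finitely many of these cover the compact one, where
    additivity and monotonicity of [L] suffice. *)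
Let m_sub : @measurable_subset_sigma_subadditive _ R rects m.
Proof.
move=> X F mF mX XF.
have /choice[A /choice[B AB]] n : exists A B : set E,
    [/\ measurable (A : set (borel E)), measurable (B : set (borel E))
      & F n = A `*` B].
  by have [A mA [B mB AB]] := mF n; exists A, B.
have [A0 mA0 [B0 mB0 XE]] := mX.
set s := (\sum_(n <oo) m (F n))%E.
apply/lee_addgt0Pr => e e0.
have e4 : 0 < e / 4 by rewrite divr_gt0.
have en n : 0 < e / 4 / (2 ^ n.+1)%:R by rewrite divr_gt0// ltr0n expn_gt0.
have [K [cK KA mK muK]] := polish_compact_inner_regular hE mu mA0 e4.
have [K' [cK' KB mK' nuK]] := polish_compact_inner_regular hE nu mB0 e4.
have /choice[U UP] n : exists U : set E,
    [/\ open U, A n `<=` U & (mu (U `\` A n) < (e / 4 / (2 ^ n.+1)%:R)%:E)%E].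
  by have [mA _ _] := AB n; exact: (polish_open_outer_regular hE mu mA (en n)).
have /choice[V VP] n : exists V : set E,
    [/\ open V, B n `<=` V & (nu (V `\` B n) < (e / 4 / (2 ^ n.+1)%:R)%:E)%E].
  by have [_ mB _] := AB n; exact: (polish_open_outer_regular hE nu mB (en n)).
have [|||N KN] := @compact_rectangles_cover K K' U V cK cK'.
- by move=> n; have [] := UP n.
- by move=> n; have [] := VP n.
- move=> [x y] [/= Kx Ky].
  have [|n _] := XF (x, y); first by rewrite -XE; split; [exact: KA|exact: KB].
  have [_ _ ->] := AB n => -[/= Ax By]; exists n => //.
  have [_ AU _] := UP n; have [_ BV _] := VP n.
  by split; [exact: AU|exact: BV].
have fine_lt (p : probability (borel E) R) (D : set E) (x : R) :
    measurable (D : set (borel E)) -> (p D < x%:E)%E -> fine (p D) < x.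
  by move=> mD; rewrite -lte_fin fineK//; exact: fin_num_measure.
have mU n : measurable (U n : set (borel E)).
  by apply: open_measurable_borel; have [] := UP n.
have mV n : measurable (V n : set (borel E)).
  by apply: open_measurable_borel; have [] := VP n.
have H1 : L \1_X <= L \1_(K `*` K') + e / 2.
  rewrite -XE; apply: le_trans (L_setD mA0 mB0 mK mK' KA KB) _.
  have := fine_lt mu _ _ (measurableD mA0 mK) muK.
  have := fine_lt nu _ _ (measurableD mB0 mK') nuK.
  by move: (fine _) (fine _) => a b; lra.
have H2 n : L \1_(U n `*` V n) <= L \1_(F n) + e / 2 / (2 ^ n.+1)%:R.
  have [mA mB ->] := AB n; have [_ AU muU] := UP n; have [_ BV nuV] := VP n.
  apply: le_trans (L_setD (mU n) (mV n) mA mB AU BV) _.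
  have := fine_lt mu _ _ (measurableD (mU n) mA) muU.
  have := fine_lt nu _ _ (measurableD (mV n) mB) nuV.
  have -> : e / 2 / (2 ^ n.+1)%:R =
      e / 4 / (2 ^ n.+1)%:R + e / 4 / (2 ^ n.+1)%:R.
    by rewrite -!mulrDl; congr (_ * _); lra.
  by move: (fine _) (fine _) (_ / _) => a b k; lra.
have H3 : L \1_(K `*` K') <= \sum_(0 <= n < N) L \1_(U n `*` V n).
  rewrite -L_sum; apply: L_mono => // z.
  rewrite fct_sumE; case: (pselect ((K `*` K') z)) => [Kz|nKz]; last first.
    rewrite indicE memNset//; apply: sumr_ge0 => n _.
    by rewrite indicE.
  have [n /= nN UVz] := KN z Kz.
  rewrite big_mkord (bigD1 (Ordinal nN))//= !indicE !mem_set//.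
  by rewrite lerDl; apply: sumr_ge0 => i _; rewrite indicE.
apply: (@le_trans _ _ ((\sum_(0 <= n < N)
    (m (F n) + (e / 2 / (2 ^ n.+1)%:R)%:E)) + (e / 2)%:E)%E).
  rewrite /m; under eq_bigr do rewrite -EFinD.
  rewrite sumEFin -EFinD lee_fin.
  apply: (le_trans H1); rewrite lerD2r; apply: (le_trans H3).
  by apply: ler_sum => n _; exact: H2.
have -> : (s + e%:E = s + (e / 2)%:E + (e / 2)%:E)%E.
  by rewrite -addeA -EFinD; congr (_ + _%:E)%E; lra.
rewrite leeD2r//.
apply: (@le_trans _ _ (\sum_(n <oo) (m (F n) + (e / 2 / (2 ^ n.+1)%:R)%:E))%E).
  apply: nneseries_lim_ge => n _ _.
  by rewrite adde_ge0 ?lee_fin ?L_indic_ge0// divr_ge0// divr_ge0// ltW.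
apply: epsilon_trick => [n|]; first by rewrite lee_fin.
by rewrite divr_ge0// ltW.
Qed.

Let prod_borel := (borel E * borel E)%type.

Section on_coupling.
Variable Q : probability prod_borel R.
Hypothesis QE : forall A B : set E, measurable (A : set (borel E)) ->
  measurable (B : set (borel E)) -> Q (A `*` B) = m (A `*` B).

(** Inclusion-exclusion: meeting [n] rectangles with one more again yields [n] rectangles, so the
    induction hypothesis, for other [A] and [B], settles the intersection. *)
Let Q_bigsetU (n : nat) (A B : nat -> set E) :
  (forall i, measurable (A i : set (borel E))) ->
  (forall i, measurable (B i : set (borel E))) ->
  Q (\big[setU/set0]_(i < n) (A i `*` B i)) =
  m (\big[setU/set0]_(i < n) (A i `*` B i)).
Proof.
elim: n A B => [|n IH] A B mA mB.
  by rewrite !big_ord0 measure0 /m indic0 L0.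
rewrite !big_ord_recr/=.
set W := \big[setU/set0]_(i < n) (A i `*` B i).
have mW : measurable (W : set prod_borel).
  by apply: bigsetU_measurable => i _; exact: measurableX.
have mX : measurable (A n `*` B n : set prod_borel) by exact: measurableX.
have WI : W `&` (A n `*` B n) =
    \big[setU/set0]_(i < n) ((A i `&` A n) `*` (B i `&` B n)).
  by rewrite /W big_distrl/=; apply: eq_bigr => i _; rewrite setXI.
have QI : Q (W `&` (A n `*` B n)) = m (W `&` (A n `*` B n)).
  rewrite WI; apply: (IH (fun i => A i `&` A n) (fun i => B i `&` B n)) => i.
    exact: measurableI.
  exact: measurableI.
rewrite (measureUfinr (mu := Q))//; last first.
  by apply: le_lt_trans (probability_le1 Q mX) (ltry _).
rewrite [X in (X + _ - _)%E](IH A B mA mB) -/W.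
rewrite [X in (_ + X - _)%E](QE (mA n) (mB n)) [X in (_ - X)%E]QI /m.
suff -> : L \1_(W `|` A n `*` B n) =
  L \1_W + L \1_(A n `*` B n) - L \1_(W `&` A n `*` B n) by [].
have -> : W `|` A n `*` B n = W `|` (A n `*` B n `\` W).
  by rewrite setUDr setDv setD0.
rewrite (L_indicU (A := W)); last by rewrite -subset0 => z [Wz [_ nWz]].
have XE : A n `*` B n = (A n `*` B n `\` W) `|` (W `&` (A n `*` B n)).
  apply/seteqP; split=> z; last by move=> [[]|[]].
  by move=> Xz; have [Wz|nWz] := pselect (W z); [right|left].
rewrite [in X in _ = _ + X - _]XE L_indicU; last first.
  by rewrite -subset0 => z [[_ nWz] [Wz _]].
by rewrite -addrA addrK.
Qed.

Let mc : measurable_fun setT (fun z : prod_borel => c z.1 z.2).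
Proof. exact: lsc_cost_measurable. Qed.

Let superlevel_measurable (N j : nat) :
  measurable [set z : prod_borel | j.+1%:R < N.+1%:R * c z.1 z.2].
Proof.
have mNc : measurable_fun setT (fun z : prod_borel => N.+1%:R * c z.1 z.2).
  exact: measurable_funM.
have := mNc measurableT `]j.+1%:R, +oo[%classic (measurable_itv _).
rewrite setTI; congr measurable.
by apply/seteqP; split=> z /=; rewrite in_itv/= andbT.
Qed.

(** The indicators of the superlevel sets sum to at most [N.+1%:R * c], priced at [N.+1%:R * S] by
    [Lle] with zero potentials. [Q] and [L] are compared on finite unions of rectangles, so each
    superlevel set is first approximated from inside by such a union. *)
Let superlevel_sum (N : nat) (n : nat) :
  \sum_(j < n) fine (Q [set z | j.+1%:R < N.+1%:R * c z.1 z.2]) <= N.+1%:R * S.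
Proof.
have N0 : 0 < N.+1%:R :> R by rewrite ltr0n.
pose G (j : nat) : set prod_borel := [set z | j.+1%:R < N.+1%:R * c z.1 z.2].
have oG j : open (G j : set (E * E)).
  rewrite (_ : G j = [set z : E * E | j.+1%:R / N.+1%:R < c z.1 z.2]).
    exact: lsc_cost_open.
  by apply/seteqP; split=> z /=; rewrite ltr_pdivrMr// mulrC.
have mG j : measurable (G j) by exact: superlevel_measurable.
apply/ler_addgt0Pr => e e0.
have d0 : 0 < e / n.+1%:R by rewrite divr_gt0.
have /choice[W WP] j : exists W : set (E * E), W `<=` G j /\
    fine (Q (G j)) <= L \1_W + e / n.+1%:R.
  have [U [V [oUV GE]]] := polish_open_bigcup_rectangles hE (oG j).
  have mU i : measurable (U i : set (borel E)).
    by apply: open_measurable_borel; have [] := oUV i.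
  have mV i : measurable (V i : set (borel E)).
    by apply: open_measurable_borel; have [] := oUV i.
  pose W k : set prod_borel := \big[setU/set0]_(i < k) (U i `*` V i).
  have mW k : measurable (W k).
    by apply: bigsetU_measurable => i _; exact: measurableX.
  have WE k : W k = \bigcup_(i < k) (U i `*` V i) by rewrite bigcup_mkord.
  have WG k : W k `<=` G j.
    by rewrite WE GE => z [i _ UVz]; exists i.
  have [k Hk] : exists k, (Q (G j `\` W k) < (e / n.+1%:R)%:E)%E.
    apply: probability_nonincreasing_lt => [k||].
    - exact: measurableD.
    - apply/nonincreasing_seqP => k; apply/subsetPset; apply: setDS.
      by rewrite /W big_ord_recr; exact: subsetUl.
    - rewrite (_ : \bigcap_k _ = set0) ?measure0 ?lte_fin//.
      rewrite -subset0 => z Gz; have [+ _] := Gz 0%N I.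
      rewrite GE => -[i _ UVz]; have [_] := Gz i.+1 I; apply.
      by rewrite WE; exists i => /=.
  exists (W k); split=> //.
  have WQ : Q (W k) = (L \1_(W k))%:E by exact: Q_bigsetU.
  have GWQ : Q (G j) = (Q (W k) + Q (G j `\` W k))%E.
    rewrite -measureU//; last 2 first.
      exact: measurableD.
      by rewrite setDIK.
    by congr (Q _); rewrite setDUK.
  have fGW : Q (G j `\` W k) \is a fin_num.
    by apply: fin_num_measure; exact: measurableD.
  rewrite GWQ WQ fineD// lerD2l -lee_fin fineK//; exact: ltW.
apply: (@le_trans _ _ (\sum_(j < n) (L \1_(W j) + e / n.+1%:R))).
  by apply: ler_sum => j _; have [] := WP j.
rewrite big_split/= sumr_const card_ord -L_sum lerD//.
  have b0 : bounded_borel (fun _ : E => 0 : R) by exact: bounded_measurable_cst.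
  have := Lle (bounded_sum (index_enum 'I_n) (fun j => W j)) b0 b0 N0.
  rewrite (Rintegral_probability_cst mu) (Rintegral_probability_cst nu) !add0r.
  apply=> z; rewrite ?add0r.
  apply: le_trans (sum_lt_nat_le n (mulr_ge0 (ltW N0) (c0 z.1 z.2))).
  rewrite fct_sumE; apply: ler_sum => j _.
  have [WG _] := WP j.
  rewrite indicE; case: (boolP (z \in W j)) => [/set_mem/WG/= ->//|_].
  by rewrite ler0n.
rewrite -[leLHS]mulr_natl mulrA ler_pdivrMr// mulrC ler_pM2l//.
by rewrite ler_nat.
Qed.

(** The layer-cake bounds for [N.+1%:R * c] give a truncated integral of at most [S + N.+1%:R^-1];
    the error vanishes as the truncation level grows. *)
Let cost_le : (\int[Q]_z (c z.1 z.2)%:E <= S%:E)%E.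
Proof.
have bcN k : bounded_measurable
    (fun z : prod_borel => Num.min (c z.1 z.2) k.+1%:R).
  split; first exact: measurable_minr.
  exists k.+1%:R => z; rewrite ger0_norm ?ge_min ?lexx ?orbT//.
  by rewrite le_min c0 ler0n.
have trunc_le (N : nat) :
    \int[Q]_z Num.min (c z.1 z.2) N.+1%:R <= S + N.+1%:R^-1.
  have N0 : 0 < N.+1%:R :> R by rewrite ltr0n.
  pose G (j : nat) : set prod_borel := [set z | j.+1%:R < N.+1%:R * c z.1 z.2].
  (* With this count, [N.+1] times the truncation of [c] at [N.+1] is the truncation of
     [N.+1%:R * c] at [n]. *)
  pose n := (N.+1 * N.+1)%N.
  have [bG intG] := @Rintegral_sum_indic R _ prod_borel Q G n
    (superlevel_measurable N).
  have b1 : bounded_measurable (fun _ : prod_borel => 1 : R).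
    exact: bounded_measurable_cst.
  have : \int[Q]_z (N.+1%:R * Num.min (c z.1 z.2) N.+1%:R) <=
      \int[Q]_z (\sum_(j < n) \1_(G j) z + 1).
    apply: le_Rintegral_bounded_measurable.
    - exact: bounded_measurableZ.
    - exact: bounded_measurableD.
    - move=> z; rewrite minr_pMr ?ler0n// -natrM.
      apply: le_trans (sum_lt_nat_ge _ _) _.
      rewrite lerD2r; apply: ler_sum => j _; rewrite indicE ler_nat.
      by case: (boolP (_ < _)) => // H; rewrite mem_set.
  rewrite Rintegral_bounded_measurableZ// Rintegral_bounded_measurableD//.
  rewrite intG (Rintegral_probability_cst Q) => H.
  have := superlevel_sum N n; rewrite -/G => H'.
  rewrite -(ler_pM2l N0) mulrDr divff ?gt_eqF//.
  by apply: le_trans H _; rewrite lerD2r.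
apply: ge0_integral_le_truncation => // N.
have H : \int[Q]_z Num.min (c z.1 z.2) N.+1%:R <= S.
  apply/ler_addgt0Pr => e e0.
  have [k] := ltr_add_invr e0; rewrite add0r => ke.
  (* Raising the truncation level to [(maxn N k).+1] can only increase the integral, and it brings
     the error below [e]. *)
  apply: (@le_trans _ _ (\int[Q]_z Num.min (c z.1 z.2) (maxn N k).+1%:R)).
    apply: le_Rintegral_bounded_measurable => // z.
    by rewrite le_min ge_min lexx/= ge_min ler_nat ltnS leq_maxl orbT.
  apply: le_trans (trunc_le _) _; rewrite lerD2l.
  apply: le_trans (ltW ke); rewrite lef_pV2 ?posrE ?ltr0n//.
  by rewrite ler_nat ltnS leq_maxr.
rewrite -[leLHS]fineK ?lee_fin//.
by apply: integrable_fin_num => //; exact: bounded_measurable_integrable.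
Qed.

Lemma coupling_of_functional_on : [/\
  forall A : set E, measurable (A : set (borel E)) -> Q (A `*` setT) = mu A,
  forall A : set E, measurable (A : set (borel E)) -> Q (setT `*` A) = nu A &
  (\int[Q]_z (c z.1 z.2)%:E <= S%:E)%E].
Proof.
split; last exact: cost_le.
- move=> A mA; rewrite QE// /m L_indicl// fineK//; exact: fin_num_measure.
- move=> A mA; rewrite QE// /m L_indicr// fineK//; exact: fin_num_measure.
Qed.

End on_coupling.

Lemma coupling_of_functional : exists Q : probability prod_borel R, [/\
  forall A : set E, measurable (A : set (borel E)) -> Q (A `*` setT) = mu A,
  forall A : set E, measurable (A : set (borel E)) -> Q (setT `*` A) = nu A &
  (\int[Q]_z (c z.1 z.2)%:E <= S%:E)%E].
Proof.
have [||||Q QE] := @measure_of_rectangles _ _ (borel E) (borel E) R m.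
- by move=> A; rewrite lee_fin.
- exact: m_add.
- exact: m_sub.
- exact: (congr1 EFin L_indicT).
by exists Q; exact: coupling_of_functional_on.
Qed.

End coupling.

(** * Duality and the fractional order *)

Section eq_law.
Context (R : realType) d d' d'' (T : measurableType d) (T' : measurableType d')
  (S : measurableType d'') (P : probability T R) (P' : probability T' R)
  (X : {RV P >-> S}) (X' : {RV P' >-> S}).
Hypothesis XX' : eq_law X' X.

Let mX : measurable_fun setT X. Proof. exact: measurable_funPT. Qed.
Let mX' : measurable_fun setT X'. Proof. exact: measurable_funPT. Qed.

Lemma eq_law_ge0_integral (f : S -> \bar R) :
  measurable_fun setT f -> (forall y, (0 <= f y)%E) ->
  (\int[P']_w f (X' w) = \int[P]_w f (X w))%E.
Proof.
move=> mf f0.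
rewrite -[LHS](ge0_integral_distribution X' mf f0).
rewrite -[RHS](ge0_integral_distribution X mf f0).
by apply: eq_measure_integral => A mA _; exact: XX'.
Qed.

Lemma eq_law_integrable (f : S -> R) : measurable_fun setT f ->
  P.-integrable setT (fun w => (f (X w))%:E) ->
  P'.-integrable setT (fun w => (f (X' w))%:E).
Proof.
move=> mf /integrableP[_ fX]; apply/integrableP; split.
  by apply/measurable_EFinP; exact: measurableT_comp.
rewrite (@eq_law_ge0_integral (fun x => `|(f x)%:E|%E))//.
by apply: measurableT_comp => //; exact/measurable_EFinP.
Qed.

Lemma eq_law_Rintegral (f : S -> R) : measurable_fun setT f ->
  P.-integrable setT (fun w => (f (X w))%:E) ->
  \int[P']_w f (X' w) = \int[P]_w f (X w).
Proof.
move=> mf fX; rewrite /Rintegral.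
have mEf : measurable_fun setT (EFin \o f) by exact/measurable_EFinP.
rewrite -[in LHS](integral_distribution mEf (eq_law_integrable mf fX)).
rewrite -[in RHS](integral_distribution mEf fX).
by congr fine; apply: eq_measure_integral => A mA _; exact: XX'.
Qed.

End eq_law.

Lemma Rintegral_distribution (R : realType) d d' (T : measurableType d)
    (S : measurableType d') (P : probability T R) (X : {RV P >-> S})
    (f : S -> R) : bounded_measurable f ->
  \int[distribution P X]_x f x = \int[P]_w f (X w).
Proof.
move=> [mf [M fM]]; rewrite /Rintegral.
have mX : measurable_fun setT X by exact: measurable_funPT.
rewrite -[in RHS](@integral_distribution _ _ _ _ _ _ X (EFin \o f))//.
  exact/measurable_EFinP.
apply: bounded_measurable_integrable; split; first exact: measurableT_comp.
by exists M => w; exact: fM.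
Qed.

Lemma expectation_Rintegral (R : realType) d (T : measurableType d)
    (P : probability T R) (f : T -> R) :
  P.-integrable setT (EFin \o f) -> ('E_P[f] = (\int[P]_w f w)%:E)%E.
Proof.
by move=> fi; rewrite unlock /Rintegral fineK//; exact: integrable_fin_num.
Qed.

(** * Finiteness and duality for the transport cost *)

Section fractional.
Variables (R : realType) (E : ptopologicalType) (c : E -> E -> R) (g : E -> R).
Context (d : measure_display) (Omega : measurableType d)
  (P : probability Omega R).
Hypothesis hE : polish_space R E.
Hypothesis hc : quasi_pseudo_metric c.
Hypothesis hlsc : lsc_cost c.
Hypothesis hg : measurable_fun [set: borel E] g.
Implicit Types X Y : {RV P >-> borel E}.

Let c_ge0 x y : 0 <= c x y. Proof. by have [+ _ _] := hc; apply. Qed.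
Let c_tri x y z : c x z <= c x y + c y z.
Proof. by have [_ _ +] := hc; apply. Qed.

Lemma cost_measurable d' (T : measurableType d') (a b : T -> borel E) :
  measurable_fun setT a -> measurable_fun setT b ->
  measurable_fun setT (fun w => c (a w) (b w)).
Proof.
move=> ma mb; have mab := measurable_fun_pair ma mb.
exact: (measurableT_comp (lsc_cost_measurable hlsc hE) mab).
Qed.

Lemma in_L_integrable X : in_L c g X -> exists x0 : E,
  [/\ P.-integrable setT (fun w => (c (X w) x0)%:E),
      P.-integrable setT (fun w => (c x0 (X w))%:E) &
      P.-integrable setT (fun w => (g (X w))%:E)].
Proof.
move=> [x0 hx0]; exists x0.
have mX : measurable_fun setT X by exact: measurable_funPT.
have mc1 : measurable_fun setT (fun w => c (X w) x0) by exact: cost_measurable.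
have mc2 : measurable_fun setT (fun w => c x0 (X w)) by exact: cost_measurable.
have mg : measurable_fun setT (fun w => g (X w)) by exact: measurableT_comp.
have iS : P.-integrable setT
    (fun w => (c (X w) x0 + c x0 (X w) + `|g (X w)|)%:E).
  apply/integrableP; split.
    apply/measurable_EFinP.
    apply: measurable_funD; first exact: measurable_funD.
    exact: measurableT_comp.
  move: hx0; rewrite unlock.
  by under eq_integral do rewrite -[X in X%:E]ger0_norm ?addr_ge0//.
have le_iS (f : Omega -> R) : measurable_fun setT f ->
    (forall w, `|f w| <= c (X w) x0 + c x0 (X w) + `|g (X w)|) ->
    P.-integrable setT (fun w => (f w)%:E).
  move=> mf fle; apply: (le_integrable _ _ _ iS) => //.
    exact/measurable_EFinP.
  by move=> w _; rewrite /= lee_fin; apply: le_trans (fle w) (ler_norm _).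
split; apply: le_iS => // w.
- by rewrite ger0_norm// -addrA lerDl addr_ge0.
- by rewrite ger0_norm// addrAC lerDr addr_ge0.
- by rewrite lerDr addr_ge0.
Qed.

(** The absolute value of [f (X w)] is at most [c (X w) x0 + c x0 (X w) + |f x0|]; both directions
    enter because [c] need not be symmetric. *)
Lemma in_L_integrable_lipschitz X (f : E -> R) : in_L c g X ->
  measurable_fun [set: borel E] f -> (forall x y, f x - f y <= c x y) ->
  P.-integrable setT (fun w => (f (X w))%:E).
Proof.
move=> /in_L_integrable[x0 [i1 i2 _]] mf flip.
have mX : measurable_fun setT X by exact: measurable_funPT.
have iS : P.-integrable setT
    (fun w => (c (X w) x0 + (c x0 (X w) + `|f x0|))%:E).
  have ik := finite_measure_integrable_cst P `|f x0| measurableT.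
  exact: (integrableD measurableT i1 (integrableD measurableT i2 ik)).
apply: (le_integrable _ _ _ iS) => //.
  by apply/measurable_EFinP; exact: measurableT_comp.
move=> w _; rewrite /= lee_fin; apply: le_trans (ler_norm _).
have := flip (X w) x0; have := flip x0 (X w).
have := c_ge0 (X w) x0; have := c_ge0 x0 (X w).
have := ler_norm (f x0); have := ler_norm (- f x0); rewrite normrN => *.
by rewrite ler_norml; apply/andP; split; lra.
Qed.

Lemma OT_ge0 X Y : (0 <= OT c X Y)%E.
Proof.
apply: le_ereal_inf_tmp => _ [d' [T' [Q [X' [Y' [_ _ ->]]]]]].
by rewrite unlock; apply: integral_ge0 => w _; rewrite lee_fin.
Qed.

(** [X] and [Y] form a coupling on their own space, and passing through the base points [x0] and
    [y0] bounds its cost. *)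
Lemma OT_lty X Y : in_L c g X -> in_L c g Y -> (OT c X Y < +oo)%E.
Proof.
move=> /in_L_integrable[x0 [i1 _ _]] /in_L_integrable[y0 [_ i2 _]].
have mX : measurable_fun setT X by exact: measurable_funPT.
have mY : measurable_fun setT Y by exact: measurable_funPT.
have iS : P.-integrable setT
    (fun w => (c (X w) x0 + (c y0 (Y w) + c x0 y0))%:E).
  have ik := finite_measure_integrable_cst P (c x0 y0) measurableT.
  exact: (integrableD measurableT i1 (integrableD measurableT i2 ik)).
apply: (@le_lt_trans _ _ ('E_P[fun w => c (X w) (Y w)])%E).
  by apply: ereal_inf_lbound; exists d, Omega, P, X, Y.
rewrite unlock; apply: (le_lt_trans _ (integrable_lty _ iS)) => //.
apply: ge0_le_integral => //.
- by move=> w _; rewrite lee_fin.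
- by apply/measurable_EFinP; exact: cost_measurable.
- by case/integrableP : iS.
- move=> w _; rewrite lee_fin.
  by have := c_tri (X w) x0 (Y w); have := c_tri x0 y0 (Y w); lra.
Qed.

Lemma OT_weak_duality X Y (f : E -> R) : in_L c g X -> in_L c g Y ->
  measurable_fun [set: borel E] f -> (forall x y, f x - f y <= c x y) ->
  ((\int[P]_w f (X w) - \int[P]_w f (Y w))%:E <= OT c X Y)%E.
Proof.
move=> LX LY mf flip.
have iX := in_L_integrable_lipschitz LX mf flip.
have iY := in_L_integrable_lipschitz LY mf flip.
apply: le_ereal_inf_tmp => _ [d' [T' [Q [X' [Y' [lX lY ->]]]]]].
have mX' : measurable_fun setT X' by exact: measurable_funPT.
have mY' : measurable_fun setT Y' by exact: measurable_funPT.
rewrite -(eq_law_Rintegral lX mf iX) -(eq_law_Rintegral lY mf iY).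
have iX' := eq_law_integrable lX mf iX.
have iY' := eq_law_integrable lY mf iY.
rewrite unlock.
(* A coupling of infinite cost satisfies the bound trivially; otherwise its cost is integrable. *)
have [|c_lty] := leP +oo%E (\int[Q]_w (c (X' w) (Y' w))%:E)%E.
  by rewrite leye_eq => /eqP ->; rewrite leey.
have mc : measurable_fun setT (fun w => c (X' w) (Y' w)).
  exact: cost_measurable.
have ic : Q.-integrable setT (fun w => (c (X' w) (Y' w))%:E).
  apply/integrableP; split; first exact/measurable_EFinP.
  by under eq_integral do rewrite gee0_abs ?lee_fin//.
rewrite -RintegralB// /Rintegral fineK; last first.
  by apply: integrable_fin_num => //; exact: (integrableB measurableT iX' iY').
apply: le_integral => //; first exact: (integrableB measurableT iX' iY').
by move=> w _; rewrite lee_fin.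
Qed.

(** The bound [S] for single potentials extends to pairs and yields the functional [L], then the law
    [Q], whose coordinate projections are the required coupling. *)
Lemma OT_strong_duality X Y (S : R) :
  (forall f : E -> R, bounded_borel f -> (forall x y, f x - f y <= c x y) ->
     \int[P]_w f (X w) - \int[P]_w f (Y w) <= S) ->
  (OT c X Y <= S%:E)%E.
Proof.
move=> HS.
pose mu : probability (borel E) R := distribution P X.
pose nu : probability (borel E) R := distribution P Y.
have HS' (f : E -> R) : bounded_borel f -> (forall x y, f x - f y <= c x y) ->
    \int[mu]_x f x - \int[nu]_x f x <= S.
  by move=> bf flip; rewrite !Rintegral_distribution//; exact: HS.
have [L [LD Lle]] := kantorovich_rubinstein_functional
  (kantorovich_rubinstein_bound hE hc hlsc HS') c_ge0.
have [Q [Q1 Q2 Qc]] := coupling_of_functional hE hlsc c_ge0 LD Lle.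
pose X' : {RV Q >-> borel E} := HB.pack (fst : borel E * borel E -> borel E)
  (isMeasurableFun.Build _ _ _ _ _ (@measurable_fst _ _ (borel E) (borel E))).
pose Y' : {RV Q >-> borel E} := HB.pack (snd : borel E * borel E -> borel E)
  (isMeasurableFun.Build _ _ _ _ _ (@measurable_snd _ _ (borel E) (borel E))).
apply: le_trans Qc; apply: ereal_inf_lbound.
exists _, _, Q, X', Y'; split; last by rewrite unlock.
- move=> A mA; rewrite -[RHS](Q1 A mA) /distribution/= /pushforward/=.
  by congr (Q _); apply/seteqP; split=> -[x y] //= [].
- move=> A mA; rewrite -[RHS](Q2 A mA) /distribution/= /pushforward/=.
  by congr (Q _); apply/seteqP; split=> -[x y] //= [].
Qed.

End fractional.

(** If [D + t = 0] then both vanish, the quotient is 0 and both inequalities hold; otherwise the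
    denominator is cleared. *)
Lemma ratio_le (R : realFieldType) (t D gamma : R) :
  0 <= t -> 0 <= D -> 0 <= gamma ->
  (t / (D + t) <= gamma) = ((1 - gamma) * t <= gamma * D).
Proof.
move=> t0 D0 g0; have [Dt|Dt] := eqVneq (D + t) 0.
  have /andP[/eqP -> /eqP ->] : (D == 0) && (t == 0).
    by rewrite -paddr_eq0// Dt.
  by rewrite mul0r !mulr0 g0 lexx.
have Dt0 : 0 < D + t by rewrite lt_def Dt addr_ge0.
by rewrite ler_pdivrMr//; apply/idP/idP; lra.
Qed.

Unset Implicit Arguments.

(* The expectation of h(X) is defined only for measurable h, whence the
   measurability premise on the members h of the class. *)
Theorem theorem3p4 (R : realType) (E : ptopologicalType)
    (c : E -> E -> R) (g : E -> R)
    (d : measure_display) (Omega : measurableType d)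
    (P : probability Omega R) (gamma : R) (X Y : {RV P >-> borel E})
    (hE : polish_space R E)
    (hc : quasi_pseudo_metric c)
    (hlsc : lsc_cost c)
    (hg : measurable_fun [set: borel E] g)
    (hgamma : 0 <= gamma <= 1)
    (hX : in_L c g X) (hY : in_L c g Y) :
  gamma_le c g gamma X Y <->
  (forall h : E -> R, (gamma_class c g gamma `|` [set g]) h ->
     measurable_fun [set: borel E] h ->
     ('E_P[fun w => h (X w)] <= 'E_P[fun w => h (Y w)])%E).
Proof.
have /andP[g0 g1] := hgamma.
have c_ge0 x y : 0 <= c x y by have [+ _ _] := hc; apply.
have [_ [_ _ igX]] := in_L_integrable hE hc hlsc hg hX.
have [_ [_ _ igY]] := in_L_integrable hE hc hlsc hg hY.
have EgX := expectation_Rintegral igX; have EgY := expectation_Rintegral igY.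
have OT0 := OT_ge0 hc X Y.
have OTfin : OT c X Y \is a fin_num.
  by rewrite ge0_fin_numE//; exact: OT_lty hE hc hlsc hg X Y hX hY.
have t0 : 0 <= fine (OT c X Y) by exact: fine_ge0.
have starE : ('E_P[fun w => g (X w)] <= 'E_P[fun w => g (Y w)])%E ->
    (gamma_star c g X Y <= gamma) = ((1 - gamma) * fine (OT c X Y) <=
      gamma * (\int[P]_w g (Y w) - \int[P]_w g (X w))).
  rewrite EgX EgY lee_fin => EXY; rewrite /gamma_star EgX EgY /=.
  by rewrite ratio_le// subr_ge0.
have Eh (Z : {RV P >-> borel E}) (f : E -> R) :
    P.-integrable setT (fun w => (f (Z w))%:E) ->
    P.-integrable setT (fun w => (g (Z w))%:E) ->
    ('E_P[fun w => ((1 - gamma) * f (Z w) + gamma * g (Z w))%R])%E =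
    ((1 - gamma) * \int[P]_w f (Z w) + gamma * \int[P]_w g (Z w))%:E.
  move=> iF iG.
  have iF' : P.-integrable setT (EFin \o (fun w => (1 - gamma) * f (Z w))).
    exact: (integrableZl measurableT (1 - gamma) iF).
  have iG' : P.-integrable setT (EFin \o (fun w => gamma * g (Z w))).
    exact: (integrableZl measurableT gamma iG).
  rewrite expectation_Rintegral; last first.
    exact: (integrableD measurableT iF' iG').
  by rewrite RintegralD// !RintegralZl.
(* For [gamma = 1] every member of the class is [g], whatever [f] is, and both sides reduce to
   comparing the expectations of [g]. *)
have [gamma1|gamma_neq1] := eqVneq gamma 1.
  have gE (f : E -> R) (Z : Omega -> E) :
      (fun w => (1 - gamma) * f (Z w) + gamma * g (Z w)) = (fun w => g (Z w)).
    by apply/funext => w; rewrite gamma1 subrr mul0r add0r mul1r.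
  split=> [[EXY _] h [[f _ ->]|->] _|H]; [|exact: EXY|].
    by rewrite !gE.
  have EXY : ('E_P[fun w => g (X w)] <= 'E_P[fun w => g (Y w)])%E.
    by apply: H => //; right.
  split=> //; rewrite starE// gamma1 subrr mul0r mul1r subr_ge0.
  by move: EXY; rewrite EgX EgY lee_fin.
have g1' : 0 < 1 - gamma by rewrite subr_gt0 lt_neqAle gamma_neq1.
split=> [[EXY]|H].
- rewrite starE// => star h [[f flip ->]|->] mh; last by [].
  (* Since [1 - gamma] is nonzero, [f] is recovered from the measurable functions [h] and [g]. *)
  have mf : measurable_fun [set: borel E] f.
    have -> : f = fun x => (1 - gamma)^-1 *
        ((1 - gamma) * f x + gamma * g x - gamma * g x).
      by apply/funext => x; rewrite addrK mulKf// gt_eqF.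
    apply: measurable_funM => //; apply: measurable_funB => //.
    exact: measurable_funM.
  have ifX := in_L_integrable_lipschitz hE hc hlsc hg hX mf flip.
  have ifY := in_L_integrable_lipschitz hE hc hlsc hg hY mf flip.
  rewrite (Eh X f ifX igX) (Eh Y f ifY igY) lee_fin.
  have := OT_weak_duality hE hc hlsc hg hX hY mf flip.
  rewrite -[X in (_ <= X)%E]fineK// lee_fin -(ler_pM2l g1') => weak.
  by move: star weak; lra.
- have EXY : ('E_P[fun w => g (X w)] <= 'E_P[fun w => g (Y w)])%E.
    by apply: H => //; right.
  (* Duality is used with [S = (1 - gamma)^-1 * (gamma * (E[g(Y)] - E[g(X)]))]: the hypothesis for
     [h = (1 - gamma) f + gamma g] says exactly that [E[f(X)] - E[f(Y)] <= S]. *)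
  split=> //; rewrite starE// -ler_pdivlMl//.
  rewrite -lee_fin fineK//; apply: OT_strong_duality => // f bf flip.
  have mf : measurable_fun [set: borel E] f by have [] := bf.
  have mh : measurable_fun [set: borel E]
      (fun x => (1 - gamma) * f x + gamma * g x).
    by apply: measurable_funD; exact: measurable_funM.
  have := H _ (or_introl (ex_intro2 _ _ f flip erefl)) mh.
  have ifX := in_L_integrable_lipschitz hE hc hlsc hg hX mf flip.
  have ifY := in_L_integrable_lipschitz hE hc hlsc hg hY mf flip.
  rewrite (Eh X f ifX igX) (Eh Y f ifY igY) lee_fin.
  by rewrite ler_pdivlMl//; lra.
Qed.
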